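(* For any $\epsilon>0$ there is an algorithm for the min $s$-$t$ cut problem on weighted undirected graphs that is $(\epsilon,0)$-differentially private and that, with high probability, returns an $s$-$t$ cut whose value is at most the minimum $s$-$t$ cut value plus $O(n/\epsilon)$, where $n$ is the number of nodes of the input graph. Moreover, the running time of this private algorithm is the same as the running time of the fastest non-private min $s$-$t$ cut algorithm.
   Context: A weighted undirected graph is $G=(V,E,w)$ with $w:V^2\to\mathbb{R}_{\ge 0}$, $w(uv)>0$ iff $uv\in E$. For $A,B\subseteq V$, $E(A,B)$ is the set of edges with one endpoint in $A$ and the other in $B$, and $w(F)=\sum_{e\in F}w(e)$ for an edge set $F$. Given terminals $s\neq t$, an $s$-$t$ cut is given by a partition $(A,B)$ of $V$ with $s\in A$, $t\in B$; its value is $w(E(A,B))$. The min $s$-$t$ cut problem asks for an $s$-$t$ cut (the cut itself, not only its value) of minimum value. Two graphs $G=(V,E,w)$ and $G'=(V,E',w')$ on the same node set are neighboring if there is a pair $uv\in V^2$ with $|w(uv)-w'(uv)|\le 1$ and $w(u'v')=w'(u'v')$ for all other pairs $u'v'$. A randomized algorithm $\mathcal{A}$ is $(\epsilon,\delta)$-differentially private if for all neighboring $G,G'$ and every set $O$ of outputs, $\Pr[\mathcal{A}(G)\in O]\le e^{\epsilon}\Pr[\mathcal{A}(G')\in O]+\delta$. *)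

(* Defs.v *)
From HB Require Import structures.
From mathcomp Require Import all_boot all_order all_algebra.
From mathcomp Require Import all_classical all_reals all_analysis.

Set Implicit Arguments.
Unset Strict Implicit.
Unset Printing Implicit Defensive.

Import Order.TTheory GRing.Theory Num.Theory.
Local Open Scope ring_scope.

(** * Weighted graphs and s-t cuts *)

(* The edges are the pairs of positive weight; there are no self-loops. *)
Record wgraph (R : realType) (n : nat) := WGraph {
  wt :> 'I_n -> 'I_n -> R ;
  wt_ge0 : forall u v, 0 <= wt u v ;
  wt_sym : forall u v, wt u v = wt v u ;
  wt_irr : forall u, wt u u = 0 }.

(* For disjoint A and B each undirected edge between them is listed exactly
   once, oriented from A to B. *)
Definition edges_between (R : realType) (n : nat) (G : wgraph R n)
    (A B : {set 'I_n}) : {set 'I_n * 'I_n} :=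
  [set e : 'I_n * 'I_n | [&& e.1 \in A, e.2 \in B & 0 < G e.1 e.2]]%SET.

Definition edge_weight (R : realType) (n : nat) (G : wgraph R n)
    (F : {set 'I_n * 'I_n}) : R :=
  \sum_(e in F) G e.1 e.2.

(* The cut (A, B) is represented by A, with B := ~: A. *)
Definition is_st_cut (n : nat) (s t : 'I_n) (A : {set 'I_n}) : bool :=
  (s \in A) && (t \in ~: A)%SET.

Definition cut_value (R : realType) (n : nat) (G : wgraph R n)
    (A : {set 'I_n}) : R :=
  edge_weight G (edges_between G A (~: A)%SET).

(* [set s] is an s-t cut as soon as s != t, so the minimum is attained. *)
Definition min_cut_value (R : realType) (n : nat) (G : wgraph R n)
    (s t : 'I_n) : R :=
  cut_value G [arg min_(A < [set s]%SET | is_st_cut s t A) cut_value G A]%O.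

Definition is_min_st_cut (R : realType) (n : nat) (G : wgraph R n)
    (s t : 'I_n) (A : {set 'I_n}) : Prop :=
  is_st_cut s t A /\ cut_value G A = min_cut_value G s t.

Definition neighboring (R : realType) (n : nat) (G G' : wgraph R n) : Prop :=
  exists u v : 'I_n,
    `|G u v - G' u v| <= 1 /\
    forall u' v' : 'I_n, (u', v') <> (u, v) -> (u', v') <> (v, u) ->
      G u' v' = G' u' v'.

(** * Randomized real RAM

    Unit-cost model with natural-number and real registers, a memory of
    naturals and a memory of reals (both addressed indirectly through natural
    registers), and an instruction that draws a fresh standard exponential
    variate.  The randomness is an infinite tape of reals read sequentially. *)

Variant arith := Add | Sub | Mul | Div.

Definition nat_arith (o : arith) (x y : nat) : nat :=
  match o with
  | Add => x + y | Sub => x - y | Mul => x * y | Div => x %/ y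
  end%N.

Definition real_arith (R : realType) (o : arith) (x y : R) : R :=
  match o with
  | Add => x + y | Sub => x - y | Mul => x * y | Div => x / y
  end.

Variant instr (R : realType) :=
  | NSet of nat & nat              (* N[d] := k *)
  | NOp of arith & nat & nat & nat (* N[d] := N[a] op N[b] *)
  | NLoad of nat & nat             (* N[d] := natmem[N[a]] *)
  | NStore of nat & nat            (* natmem[N[a]] := N[b] *)
  | RSet of nat & R                (* R[d] := r *)
  | ROp of arith & nat & nat & nat (* R[d] := R[a] op R[b] *)
  | RLoad of nat & nat             (* R[d] := realmem[N[a]] *)
  | RStore of nat & nat            (* realmem[N[a]] := R[b] *)
  | RSample of nat.                (* R[d] := next tape entry *)

Variant test := NLt of nat & nat | RLt of nat & nat.

Inductive prog (R : realType) :=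
  | Skip
  | Do of instr R
  | Seq of prog R & prog R
  | If of test & prog R & prog R
  | While of test & prog R.
Arguments Skip {R}.

Record state (R : realType) := State {
  nreg : nat -> nat ;
  rreg : nat -> R ;
  nmem : nat -> nat ;
  rmem : nat -> R ;
  tape : nat -> R }.

Definition upd (T : Type) (f : nat -> T) (i : nat) (x : T) : nat -> T :=
  fun j => if j == i then x else f j.

Definition exec_instr (R : realType) (i : instr R) (st : state R) : state R :=
  let: State N X mN mX w := st in
  match i with
  | NSet d k => State (upd N d k) X mN mX w
  | NOp o d a b => State (upd N d (nat_arith o (N a) (N b))) X mN mX w
  | NLoad d a => State (upd N d (mN (N a))) X mN mX w
  | NStore a b => State N X (upd mN (N a) (N b)) mX w
  | RSet d r => State N (upd X d r) mN mX w
  | ROp o d a b => State N (upd X d (real_arith o (X a) (X b))) mN mX w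
  | RLoad d a => State N (upd X d (mX (N a))) mN mX w
  | RStore a b => State N X mN (upd mX (N a) (X b)) w
  | RSample d => State N (upd X d (w 0%N)) mN mX (fun k => w k.+1)
  end.

Definition eval_test (R : realType) (b : test) (st : state R) : bool :=
  match b with
  | NLt x y => (nreg st x < nreg st y)%N
  | RLt x y => rreg st x < rreg st y
  end.

(* [exec p st k st'] : started in [st], the program [p] halts in [st'] after
   exactly [k] unit-cost steps (instructions and tests). *)
Inductive exec (R : realType) :
    prog R -> state R -> nat -> state R -> Prop :=
  | exec_skip st : exec Skip st 0 st
  | exec_do i st : exec (Do i) st 1 (exec_instr i st)
  | exec_seq p q st st1 st2 k l :
      exec p st k st1 -> exec q st1 l st2 -> exec (Seq p q) st (k + l) st2
  | exec_if_true b p q st st1 k :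
      eval_test b st -> exec p st k st1 -> exec (If b p q) st k.+1 st1
  | exec_if_false b p q st st1 k :
      ~~ eval_test b st -> exec q st k st1 -> exec (If b p q) st k.+1 st1
  | exec_while_true b p st st1 st2 k l :
      eval_test b st -> exec p st k st1 -> exec (While b p) st1 l st2 ->
      exec (While b p) st (k + l).+1 st2
  | exec_while_false b p st :
      ~~ eval_test b st -> exec (While b p) st 1 st.

(** * Input and output conventions *)

(* [l] lists every edge of [G] exactly once, in one of its two orientations;
   order and orientations are arbitrary. *)
Definition edge_list (R : realType) (n : nat) (G : wgraph R n)
    (l : seq ('I_n * 'I_n)) : Prop :=
  [/\ uniq l,
      forall u v, (u, v) \in l -> 0 < G u v /\ (v, u) \notin l
    & forall u v, 0 < G u v -> (u, v) \in l \/ (v, u) \in l].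

Definition input_of (R : realType) (n : nat) (G : wgraph R n) (s t : 'I_n)
    (l : seq ('I_n * 'I_n)) : Prop :=
  s != t /\ edge_list G l.

(* Registers 0..3 hold n, m, s, t; the i-th edge (u, v) of the list occupies the
   natural memory cells 2i and 2i+1 and its weight the real memory cell i;
   everything else is zero. *)
Definition init (R : realType) (n : nat) (G : wgraph R n) (s t : 'I_n)
    (l : seq ('I_n * 'I_n)) (w : nat -> R) : state R :=
  State
    (nth 0%N [:: n; size l; nat_of_ord s; nat_of_ord t])
    (fun=> 0)
    (nth 0%N (flatten [seq [:: nat_of_ord e.1; nat_of_ord e.2] | e <- l]))
    (nth 0 [seq G e.1 e.2 | e <- l])
    w.

(* The cut is returned as an indicator vector in natural memory. *)
Definition cut_of_state (R : realType) (n : nat) (st : state R) : {set 'I_n} :=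
  [set v : 'I_n | nmem st v != 0%N]%SET.

Definition returns (R : realType) (p : prog R) (n : nat) (G : wgraph R n)
    (s t : 'I_n) (l : seq ('I_n * 'I_n)) (w : nat -> R) (A : {set 'I_n}) :
    Prop :=
  exists k st, exec p (init G s t l w) k st /\ cut_of_state n st = A.

(* An exact (non-private) algorithm; it may use randomness, but never errs. *)
Definition solves_min_st_cut (R : realType) (p : prog R) : Prop :=
  forall (n : nat) (G : wgraph R n) (s t : 'I_n) (l : seq ('I_n * 'I_n)),
    input_of G s t l ->
    forall w, exists A, returns p G s t l w A /\ is_min_st_cut G s t A.

(* [p] takes time at most [T n m] on every graph with n nodes and at most m
   edges, whatever the random tape.  The term [n + size l] charges for reading
   the edge list and writing out the cut. *)
Definition runs_in_time (R : realType) (p : prog R) (T : nat -> nat -> nat) :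
    Prop :=
  forall (n : nat) (G : wgraph R n) (s t : 'I_n) (l : seq ('I_n * 'I_n)),
    input_of G s t l ->
    forall (m : nat), (size l <= m)%N ->
    forall w, exists k st,
      exec p (init G s t l w) k st /\ (n + size l + k <= T n m)%N.

(* Up to the constant factor [C], every time bound for [p] is one for [q], where
   the 2n additional edges account for the noise edges joining each node to the
   two terminals.  In terms of the number of nodes alone this reads
   T(n) |-> C T(n); it is O(T(n, m)) for any T with T(n, m + 2n) = O(T(n, m)). *)
Definition as_fast_as (R : realType) (C : nat) (q p : prog R) : Prop :=
  forall T : nat -> nat -> nat, runs_in_time p T ->
    runs_in_time q (fun n m => C * T n (m + 2 * n))%N.

(** * Privacy and accuracy *)

(* [xi] is a sequence of independent standard exponential random variables. *)
Definition exp_source (R : realType) (d : measure_display)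
    (Omega : measurableType d) (Pr : probability Omega R)
    (xi : nat -> {RV Pr >-> R}) : Prop :=
  (forall i (A : set R), measurable A ->
     distribution Pr (xi i) A = exponential_prob 1 A) /\
  (forall (k : nat) (A : nat -> set R), (forall i, measurable (A i)) ->
     Pr (\bigcap_(i in `I_k) (xi i @^-1` A i))%classic =
     (\prod_(i < k) Pr (xi i @^-1` A i)%classic)%E).

Definition output_event (R : realType) (d : measure_display)
    (Omega : measurableType d) (Pr : probability Omega R)
    (xi : nat -> {RV Pr >-> R}) (p : prog R) (n : nat) (G : wgraph R n)
    (s t : 'I_n) (l : seq ('I_n * 'I_n)) (O : {set {set 'I_n}}) : set Omega :=
  [set omega | exists2 A : {set 'I_n},
     A \in O & returns p G s t l (fun i => xi i omega) A]%classic.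

(* Since the input graph may be presented by any of its edge lists, the
   inequality is required for all of them. *)
Definition diff_private (R : realType) (eps delta : R) (p : prog R) : Prop :=
  forall (d : measure_display) (Omega : measurableType d)
    (Pr : probability Omega R) (xi : nat -> {RV Pr >-> R}), exp_source xi ->
  forall (n : nat) (G G' : wgraph R n) (s t : 'I_n)
    (l l' : seq ('I_n * 'I_n)),
    input_of G s t l -> input_of G' s t l' -> neighboring G G' ->
  forall O : {set {set 'I_n}},
    (Pr (output_event xi p G s t l O) <=
     (expR eps)%:E * Pr (output_event xi p G' s t l' O) + delta%:E)%E.

(* [p] always halts and returns some s-t cut, and its output is a random
   variable. *)
Definition st_cut_algorithm (R : realType) (p : prog R) : Prop :=
  forall (n : nat) (G : wgraph R n) (s t : 'I_n) (l : seq ('I_n * 'I_n)),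
    input_of G s t l ->
    (forall w, exists A, returns p G s t l w A /\ is_st_cut s t A) /\
    (forall (d : measure_display) (Omega : measurableType d)
       (Pr : probability Omega R) (xi : nat -> {RV Pr >-> R}),
       exp_source xi ->
     forall O, measurable (output_event xi p G s t l O)).

(* With probability at least [1 - n^-c] the returned cut exceeds the minimum by
   at most [err n]. *)
Definition accurate (R : realType) (err : nat -> R) (c : nat) (p : prog R) :
    Prop :=
  forall (d : measure_display) (Omega : measurableType d)
    (Pr : probability Omega R) (xi : nat -> {RV Pr >-> R}), exp_source xi ->
  forall (n : nat) (G : wgraph R n) (s t : 'I_n) (l : seq ('I_n * 'I_n)),
    input_of G s t l ->
    ((1 - n%:R ^- c)%:E <=
     Pr (output_event xi p G s t l
           [set A | is_st_cut s t A &
                    (cut_value G A <= min_cut_value G s t + err n)%R]%SET))%E.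

(* "With high probability" means probability 1 - n^-c for every fixed c, the
   constant [K c] hidden in O(n/eps) depending on c only. *)
Definition private_min_cut_algorithm (R : realType) (eps : R) (K : nat -> R)
    (p : prog R) : Prop :=
  [/\ st_cut_algorithm p,
      diff_private eps 0 p
    & forall c : nat, accurate (fun n => K c * (n%:R / eps)) c p].

(* Main.v *)
(** The private algorithm joins every non-terminal node to s and to t by edges
    whose weights are independent exponential variables of rate eps/2, merging
    parallel edges, and then runs the given exact algorithm.

    Privacy: let the weight of uv change by at most 1 and let A be a minimum cut
    of the noisy graph.  Increase by 1 + delta, resp. by delta for the nodes
    other than u and v, the noise that penalizes moving a node across A.  Then A
    is the unique minimum cut of the noisy neighbor, whichever way the weight
    changed, so that tie-breaking, the order of the edge list and the randomness
    of the exact algorithm do not matter.  By memorylessness the shift costs a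
    factor exp(eps + O(delta)), and delta tends to 0.

    Accuracy: the error is at most the sum of the 2n noise variables, and a union
    bound over integer points below the noise vector bounds its tail.

    That some exact algorithm exists is shown by exhaustive search over all
    subsets, encoded in binary. *)

Require Import Defs.
From mathcomp Require Import all_boot all_order all_algebra.
From mathcomp Require Import all_classical all_reals all_analysis.
From mathcomp Require Import measurable_realfun zify ring lra.

Set Implicit Arguments.
Unset Strict Implicit.
Unset Printing Implicit Defensive.

Import Order.TTheory GRing.Theory Num.Theory.
Local Open Scope ring_scope.

(** * Executing programs *)

Section Execution.
Context {R : realType}.
Implicit Types (p q : prog R) (st : state R).

(** The exact algorithm is a black box: it may read the tape beyond the noise and break ties at
    will, so the event that it outputs A cannot be shifted directly. It is sandwiched instead: it
    lies inside the event that A is a minimum cut of the noisy graph and contains the event that A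
    is the only one. Both depend on the first 2n tape entries alone, and the slack delta turns the
    former into the latter.

    The rate is eps/2 because a competing cut may feel the change of uv by moving u alone or v
    alone. Both nodes need an extra penalty of 1, which costs 2 * (eps/2) in the exponent. As the
    additive privacy parameter is 0, it is enough to compare the probabilities of single cuts and to
    sum.

    Halting, correctness and time are claimed for every tape, also for tapes of probability 0, and
    the black box is only specified on initial states. Hence the noise is clamped at 0, and the code
    that adds it must end in exactly the initial state of the noisy graph. *)

Definition halts p st (c : nat) (Q : state R -> Prop) : Prop :=
  exists k st', [/\ exec p st k st', (k <= c)%N & Q st'].

Lemma halts_weaken p st c c' (Q Q' : state R -> Prop) :
  halts p st c Q -> (c <= c')%N -> (forall st', Q st' -> Q' st') ->
  halts p st c' Q'.
Proof.
move=> [k [st' [ek kc Qst']]] cc' QQ'; exists k, st'; split => //.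
- exact: leq_trans kc cc'.
- exact: QQ'.
Qed.

Lemma halts_seq p q st c d (P Q : state R -> Prop) :
  halts p st c P -> (forall st', P st' -> halts q st' d Q) ->
  halts (Seq p q) st (c + d) Q.
Proof.
move=> [k [st1 [e1 kc Pst1]]] /(_ _ Pst1) [k' [st2 [e2 kd Qst2]]].
by exists (k + k')%N, st2; split; [exact: exec_seq e1 e2|exact: leq_add|].
Qed.

Lemma halts_skip_seq q st c (Q : state R -> Prop) :
  halts q st c Q -> halts (Seq Skip q) st c Q.
Proof.
move=> [k [st1 [e1 kc Q1]]]; exists k, st1; split => //.
by rewrite -(add0n k); exact: exec_seq (exec_skip st) e1.
Qed.

Lemma halts_seqA p q r st c (Q : state R -> Prop) :
  halts (Seq p (Seq q r)) st c Q -> halts (Seq (Seq p q) r) st c Q.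
Proof.
move=> [k [st3 [e kc Q3]]]; exists k, st3; split => //; inversion e; subst.
match goal with H : exec (Seq q r) _ _ _ |- _ => inversion H; subst end.
by rewrite addnA; apply: exec_seq; [apply: exec_seq; eassumption|eassumption].
Qed.

(** The continuation [r] is carried into both branches, so the branches need no common
    postcondition. *)
Lemma halts_if_seq b p q r st c (Q : state R -> Prop) : (0 < c)%N ->
  (eval_test b st -> halts (Seq p r) st c.-1 Q) ->
  (~~ eval_test b st -> halts (Seq q r) st c.-1 Q) ->
  halts (Seq (If b p q) r) st c Q.
Proof.
case: c => //= c _ hp hq; have [bt|bt] := boolP (eval_test b st).
- have [k [st2 [e kc Q2]]] := hp bt.
  exists k.+1, st2; split => //; inversion e; subst.
  by rewrite -addSn; apply: exec_seq; eauto; exact: exec_if_true.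
- have [k [st2 [e kc Q2]]] := hq bt.
  exists k.+1, st2; split => //; inversion e; subst.
  by rewrite -addSn; apply: exec_seq; eauto; exact: exec_if_false.
Qed.

(** The invariant is indexed by the number of completed iterations. Each iteration pays one test
    besides its body, and the failing test adds one more. *)
Lemma halts_while b p (I : nat -> state R -> Prop) N c st :
  I 0%N st ->
  (forall j st', (j < N)%N -> I j st' ->
     eval_test b st' /\ halts p st' c (I j.+1)) ->
  (forall st', I N st' -> ~~ eval_test b st') ->
  halts (While b p) st (N * c.+1).+1 (I N).
Proof.
move=> I0 step stop.
suff H d j st' : (j + d = N)%N -> I j st' ->
    halts (While b p) st' (d * c.+1).+1 (I N) by exact: (H N 0%N).
elim: d j st' => [|d IHd] j st' jdN Ij.
  move: jdN Ij; rewrite addn0 => -> IN.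
  by exists 1%N, st'; split => //; apply: exec_while_false; exact: stop.
have [|bt [k [st1 [e1 kc I1]]]] := step j st' _ Ij; first by lia.
have [|k' [st2 [e2 kd I2]]] := IHd j.+1 st1 _ I1; first by lia.
by exists (k + k').+1, st2; split; [exact: exec_while_true e1 e2|lia|].
Qed.

Definition block (s : seq (instr R)) : prog R :=
  foldr (fun i p => Seq (Do i) p) Skip s.

Definition exec_block (s : seq (instr R)) st : state R :=
  foldl (fun st i => exec_instr i st) st s.

Lemma exec_block_exec s st : exec (block s) st (size s) (exec_block s st).
Proof.
elim: s st => [|i s IHs] st /=; first exact: exec_skip.
by rewrite -add1n; apply: exec_seq (IHs _); exact: exec_do.
Qed.

Lemma halts_block s st c (Q : state R -> Prop) : (size s <= c)%N ->
  Q (exec_block s st) -> halts (block s) st c Q.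
Proof.
move=> sc Qst; exists (size s), (exec_block s st); split => //.
exact: exec_block_exec.
Qed.

Lemma halts_block_seq s q st c (Q : state R -> Prop) : (size s <= c)%N ->
  halts q (exec_block s st) (c - size s) Q -> halts (Seq (block s) q) st c Q.
Proof.
move=> sc [k [st' [e kc Qst']]]; exists (size s + k)%N, st'; split => //.
- exact: exec_seq (exec_block_exec s st) e.
- by lia.
Qed.

(** The machine only compares strictly, so equality is the failure of both strict tests. *)
Definition if_eq (a b : nat) p : prog R := If (NLt a b) Skip (If (NLt b a) Skip p).

Lemma halts_if_eq_seq a b p q st c (Q : state R -> Prop) : (1 < c)%N ->
  (nreg st a = nreg st b -> halts (Seq p q) st c.-2 Q) ->
  (nreg st a <> nreg st b -> halts q st c.-2 Q) ->
  halts (Seq (if_eq a b p) q) st c Q.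
Proof.
move=> c1 hp hs; apply: halts_if_seq => [|/= ab|/= ab]; first by lia.
  apply: halts_skip_seq; apply: halts_weaken (hs _) _ _ => //; lia.
have [k [st2 [e kc Q2]]] : halts (Seq (If (NLt b a) Skip p) q) st c.-1 Q.
  apply: halts_if_seq => [|/= ba|/= ba]; first by lia.
    by apply: halts_skip_seq; apply: halts_weaken (hs _) _ _ => //; lia.
  by apply: halts_weaken (hp _) _ _ => //; lia.
by exists k, st2.
Qed.

(** Register files are kept as [nth] of explicit lists, so that symbolic execution reduces by
    computation. Padding with the default value, below, makes the list long enough for every
    register in use. *)
Lemma upd_nth (T : Type) (x0 : T) (s : seq T) i x :
  upd (nth x0 s) i x = nth x0 (set_nth x0 s i x).
Proof. by apply/funext => j; rewrite /upd nth_set_nth. Qed.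

Lemma updE (T : Type) (f : nat -> T) i x j :
  upd f i x j = if j == i then x else f j.
Proof. by []. Qed.

Lemma nth_nseq_cat (T : Type) (x0 : T) (s : seq T) k :
  nth x0 (s ++ nseq k x0) = nth x0 s.
Proof.
apply/funext => j; rewrite nth_cat; case: ltnP => // sj.
by rewrite nth_nseq if_same nth_default.
Qed.

End Execution.
Arguments upd : simpl never.
Arguments block : simpl never.

(** * Adding noise edges at a terminal *)

(** The real memory while noise is being added: edge weights in front, the scratch array of noise
    from [B] on, and a gap that leaves room for appended edges. *)
Definition real_array (R : realType) (ws : seq R) (B : nat) (f : nat -> R) :
    nat -> R :=
  fun a => if (a < B)%N then nth 0 ws a else f (a - B)%N.

Section RealArray.
Context {R : realType}.
Implicit Types (ws : seq R) (f : nat -> R).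

Lemma real_array0 ws B : (size ws <= B)%N ->
  real_array ws B (fun=> 0) = nth 0 ws.
Proof.
move=> wsB; apply/funext => a; rewrite /real_array; case: ltnP => // Ba.
by rewrite nth_default//; exact: leq_trans wsB Ba.
Qed.

Lemma real_array_lo ws B f i : (i < B)%N -> real_array ws B f i = nth 0 ws i.
Proof. by rewrite /real_array => ->. Qed.

Lemma real_array_hi ws B f i : real_array ws B f (B + i)%N = f i.
Proof. by rewrite /real_array ltnNge leq_addr /= addKn. Qed.

Lemma upd_real_array_lo ws B f i y : (i < B)%N ->
  upd (real_array ws B f) i y = real_array (set_nth 0 ws i y) B f.
Proof.
move=> iB; apply/funext => a; rewrite /upd /real_array nth_set_nth /=.
by case: eqVneq => [->|//]; rewrite iB.
Qed.

Lemma upd_real_array_hi ws B f i y :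
  upd (real_array ws B f) (B + i)%N y = real_array ws B (upd f i y).
Proof.
apply/funext => a; rewrite /upd /real_array.
case: ltnP => aB; first by rewrite ifF//; lia.
by congr (if _ then _ else _); lia.
Qed.

End RealArray.

Section Star.
Context {R : realType} {n : nat}.
Variables (G : wgraph R n) (tau : 'I_n) (F : nat -> R).
Hypotheses (F_ge0 : forall a, 0 <= F a) (F_tau : F tau = 0).

Definition star_weight (u v : 'I_n) : R :=
  G u v + (if u == tau then F v else 0) + (if v == tau then F u else 0).

Fact star_weight_ge0 u v : 0 <= star_weight u v.
Proof. by rewrite !addr_ge0 ?wt_ge0//; case: ifP. Qed.

Fact star_weight_sym u v : star_weight u v = star_weight v u.
Proof. by rewrite /star_weight wt_sym addrAC. Qed.

Fact star_weight_irr u : star_weight u u = 0.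
Proof.
rewrite /star_weight wt_irr add0r.
by case: eqVneq => [->|_]; rewrite ?F_tau addr0.
Qed.

Definition star : wgraph R n :=
  WGraph star_weight_ge0 star_weight_sym star_weight_irr.

Definition joins (a : nat) (e : 'I_n * 'I_n) : bool :=
  ((e.1 == tau) && (e.2 == a :> nat)) || ((e.2 == tau) && (e.1 == a :> nat)).

(* The noise that no edge of [l] at [tau] has absorbed. *)
Definition residue (l : seq ('I_n * 'I_n)) (a : nat) : R :=
  if has (joins a) l then 0 else F a.

Definition new_edges (l : seq ('I_n * 'I_n)) (vs : seq 'I_n) :=
  [seq (tau, v) | v <- vs & 0 < residue l (nat_of_ord v)].

Lemma residue_ge0 l a : 0 <= residue l a.
Proof. by rewrite /residue; case: ifP. Qed.

Lemma mem_new_edges l vs u v :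
  ((u, v) \in new_edges l vs) = [&& u == tau, v \in vs & 0 < residue l v].
Proof.
apply/mapP/and3P => [[x]|[/eqP-> vvs rv]].
  by rewrite mem_filter => /andP[rx xvs] [-> ->].
by exists v; rewrite // mem_filter rv.
Qed.

(** A pair of positive weight in [star] is either an edge of [G], already listed, or a pair at [tau]
    whose weight is unabsorbed noise. Since [F tau = 0], no pair is listed in both orientations. *)
Lemma edge_list_star l : edge_list G l -> edge_list star (l ++ new_edges l (enum 'I_n)).
Proof.
move=> [ul l1 l2].
have rP (v : 'I_n) : 0 < residue l v ->
    [/\ (tau, v) \notin l, (v, tau) \notin l & F v = residue l v].
  rewrite /residue; case: ifPn; rewrite ?ltxx// -all_predC => /allP nj Fv.
  split => //.
    by apply/negP => /nj; rewrite /= /joins /= !eqxx.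
  by apply/negP => /nj; rewrite /= /joins /= !eqxx orbT.
split.
- rewrite cat_uniq ul /=; apply/andP; split.
    apply/hasPn => -[u v]; rewrite mem_new_edges => /and3P[/eqP-> _ rv].
    by have [] := rP v rv.
  rewrite map_inj_uniq; last by move=> x y [].
  by apply: filter_uniq; exact: enum_uniq.
- move=> u v; rewrite !mem_cat !mem_new_edges !mem_enum /= => /orP[uvl|/andP[/eqP-> rv]].
    have [Guv vul] := l1 u v uvl; split.
      rewrite /star_weight; apply: ltr_wpDr; first by case: ifP.
      by apply: ltr_wpDr => //; case: ifP.
    rewrite negb_or vul /=; apply/negP => /andP[/eqP v_tau ru].
    by have [_ /negP[]] := rP _ ru; rewrite -v_tau.
  have [ntv nvt Fv] := rP v rv; split.
    rewrite /star_weight eqxx; apply: ltr_wpDr; first by case: ifP.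
    by apply: ltr_wpDl; rewrite ?wt_ge0// Fv.
  rewrite negb_or nvt /=; apply/negP => /andP[/eqP v_tau _].
  by move: rv; rewrite -Fv v_tau F_tau ltxx.
- move=> u v; rewrite !mem_cat !mem_new_edges !mem_enum /= => sw.
  have [Guv|] := boolP (0 < G u v).
    by have [->|->] := l2 _ _ Guv; [left|right].
  rewrite -leNgt => Guv0; have Guv : G u v = 0.
    by apply/eqP; rewrite eq_le Guv0 wt_ge0.
  (* Without an edge between [tau] and [x] in [G], nothing in the list can have absorbed the noise
     of [x]. *)
  have inres (x : 'I_n) : G tau x = 0 -> 0 < F x -> 0 < residue l x.
    move=> Gx Fx; rewrite /residue; case: ifPn => // /hasP[[a b] abl].
    have [Gab _] := l1 _ _ abl; rewrite /joins /=.
    case/orP => /andP[/eqP e1 /eqP/val_inj e2]; move: Gab; rewrite e1 e2.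
      by rewrite Gx ltxx.
    by rewrite wt_sym Gx ltxx.
  move: sw; rewrite /star_weight Guv add0r.
  have [ut|ut] := eqVneq u tau; have [vt|vt] := eqVneq v tau.
  + by rewrite ut vt F_tau addr0 ltxx.
  + rewrite addr0 => Fv; left; rewrite inres ?orbT//.
    by rewrite -ut.
  + rewrite add0r => Fu; right; rewrite inres ?orbT//.
    by rewrite -vt wt_sym.
  + by rewrite addr0 ltxx.
Qed.

Lemma size_new_edges l : (size (new_edges l (enum 'I_n)) <= n)%N.
Proof.
rewrite size_map size_filter (leq_trans (count_size _ _))//.
by rewrite size_enum_ord.
Qed.

End Star.

Lemma set_nth_cat (T : Type) (x0 a b : T) s1 s2 :
  set_nth x0 (s1 ++ a :: s2) (size s1) b = s1 ++ b :: s2.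
Proof. by elim: s1 => //= c s1 ->. Qed.

Lemma set_nth_rcons (T : Type) (x0 y : T) s :
  set_nth x0 s (size s) y = rcons s y.
Proof. by elim: s => //= c s ->. Qed.

(** * Layout of the edge list in natural memory *)

Definition flat (n : nat) (l : seq ('I_n * 'I_n)) : seq nat :=
  flatten [seq [:: nat_of_ord e.1; nat_of_ord e.2] | e <- l].

Section Flat.
Context {n : nat}.
Implicit Types (l : seq ('I_n * 'I_n)) (e : 'I_n * 'I_n).

Lemma flat_cat l1 l2 : flat (l1 ++ l2) = flat l1 ++ flat l2.
Proof. by rewrite /flat map_cat flatten_cat. Qed.

Lemma size_flat l : size (flat l) = (size l + size l)%N.
Proof. by elim: l => //= e l; rewrite /flat /= => ->; lia. Qed.

Lemma nth_flat1 l1 e l2 :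
  nth 0%N (flat (l1 ++ e :: l2)) (size l1 + size l1) = e.1.
Proof. by rewrite flat_cat nth_cat size_flat ltnn subnn. Qed.

Lemma nth_flat2 l1 e l2 :
  nth 0%N (flat (l1 ++ e :: l2)) (size l1 + size l1 + 1) = e.2.
Proof.
by rewrite flat_cat nth_cat size_flat ifF ?addKn//; lia.
Qed.

Lemma set_nth_flat l (u v : 'I_n) :
  nth 0%N (set_nth 0%N (set_nth 0%N (flat l) (size l + size l) u)
    (size l + size l + 1) v) = nth 0%N (flat (rcons l (u, v))).
Proof.
apply/funext => a; rewrite !nth_set_nth /= nth_set_nth /=.
rewrite -cats1 flat_cat nth_cat size_flat.
case: (ltngtP a (size l + size l)%N) => [al|al|->].
- by rewrite ifF//; lia.
- case: eqVneq => [->|a1]; first by rewrite addKn.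
  rewrite (@nth_default _ _ (flat l)) ?size_flat; last by lia.
  rewrite (@nth_default _ _ (flat [:: (u, v)]))//.
  by rewrite size_flat /=; lia.
- by rewrite ifF ?subnn//; lia.
Qed.

End Flat.

(** Exponential draws are almost surely nonnegative, but an arbitrary tape is not; clamping keeps
    every noisy graph a legitimate weighted graph. *)
Definition positive_noise (R : realType) (sc x : R) : R :=
  if 0 < x then x * sc else 0.

(* Terminals carry no noise: an edge between them costs the same in all cuts. *)
Definition tape_noise (R : realType) (n : nat) (s t : 'I_n) (sc : R)
    (w : nat -> R) (a : nat) : R :=
  if [|| a == s, a == t | (n <= a)%N] then 0 else positive_noise sc (w a).

(** * The program that adds the noise edges, and its loop invariants *)

Section StarProgram.
Context {R : realType}.

(* Register 4 is the loop counter, register 5 the base of the noise array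
   (beyond the final edge list) and register 6 the constant 1; real registers 1
   and 2 hold the noise scale and 0. *)
Definition sample_loop : prog R :=
  While (NLt 4 0)
    (Seq (block [:: RSample R 0; NOp R Add 7 5 4])
    (Seq (If (RLt 2 0) (block [:: ROp R Mul 0 0 1]) (block [:: RSet 0 0]))
         (block [:: RStore R 7 0; NOp R Add 4 4 6]))).

(** The noise cell is zeroed once its content has been merged into an edge, so that the scratch
    array always holds the residue. *)
Definition absorb (x : nat) : prog R :=
  block [:: NOp R Add 7 5 x; RLoad R 0 7; RLoad R 3 4; ROp R Add 3 3 0;
            RStore R 4 3; RStore R 7 2].

Definition absorb_loop (r : nat) : prog R :=
  While (NLt 4 1)
    (Seq (block [:: NOp R Add 7 4 4; NLoad R 8 7; NOp R Add 7 7 6; NLoad R 9 7])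
    (Seq (if_eq 8 r (absorb 9))
    (Seq (if_eq 9 r (absorb 8))
         (block [:: NOp R Add 4 4 6])))).

Definition append_loop (r : nat) : prog R :=
  While (NLt 4 0)
    (Seq (block [:: NOp R Add 7 5 4; RLoad R 0 7])
    (Seq (If (RLt 2 0)
            (block [:: RStore R 1 0; NOp R Add 8 1 1; NStore R 8 r;
                       NOp R Add 8 8 6; NStore R 8 4; NOp R Add 1 1 6;
                       RStore R 7 2])
            Skip)
         (block [:: NOp R Add 4 4 6]))).

(** The noise of both terminals is erased after sampling. The last block clears all work registers:
    a second pass, or the black box, must find a genuine initial state. *)
Definition add_star (sc : R) (r : nat) : prog R :=
  Seq (block [:: NSet R 6 1; NOp R Add 5 1 0; RSet 1 sc])
  (Seq sample_loop
  (Seq (block [:: NOp R Add 7 5 2; RStore R 7 2; NOp R Add 7 5 3; RStore R 7 2;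
                  NSet R 4 0])
  (Seq (absorb_loop r)
  (Seq (block [:: NSet R 4 0])
  (Seq (append_loop r)
       (block [:: NSet R 4 0; NSet R 5 0; NSet R 6 0; NSet R 7 0; NSet R 8 0;
                  NSet R 9 0; RSet 0 0; RSet 1 0; RSet 2 0; RSet 3 0])))))).

Variables (n : nat) (s t : 'I_n) (sc : R).
Local Notation nregs m i B a u v :=
  (nth 0%N [:: n; m; nat_of_ord s; nat_of_ord t; i; B; 1%N; a; u; v]).
Local Notation rregs x y := (nth (0 : R) [:: x; sc; 0; y]).

Lemma sample_loopP m B mN (ws : seq R) w :
  halts sample_loop
    (State (nregs m 0%N B 0%N 0%N 0%N) (rregs 0 0) mN
       (real_array ws B (fun=> 0)) w) (n * 7).+1
    (fun st => exists a x, st =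
       State (nregs m n B a 0%N 0%N) (rregs x 0) mN
         (real_array ws B
            (fun i => if (i < n)%N then positive_noise sc (w i) else 0))
         (fun k => w (n + k)%N)).
Proof.
pose I j st := exists a x, st =
  State (nregs m j B a 0%N 0%N) (rregs x 0) mN
    (real_array ws B
       (fun i => if (i < j)%N then positive_noise sc (w i) else 0))
    (fun k => w (j + k)%N).
apply: (@halts_while _ _ _ I n 6); last first.
- by move=> _ [a [x ->]]; rewrite /= ltnn.
- move=> j _ jn [a [x ->]]; split => //.
  apply: halts_block_seq => //=; rewrite !upd_nth /= addn0.
  have Ij y : y = positive_noise sc (w j) ->
      I j.+1 (State (nregs m (j + 1)%N B (B + j)%N 0%N 0%N) (rregs y 0) mN
        (upd (real_array ws B
           (fun i => if (i < j)%N then positive_noise sc (w i) else 0))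
           (B + j)%N y) (fun k => w (j + k.+1)%N)).
    move=> ->; exists (B + j)%N, (positive_noise sc (w j)).
    rewrite addn1 upd_real_array_hi; congr State.
      congr (real_array ws B _); apply/funext => i; rewrite updE ltnS.
      by case: (ltngtP i j) => [//|//|->].
    by apply/funext => k; rewrite addSnnS.
  apply: halts_if_seq => //= wj.
    apply: halts_block_seq => //=; apply: halts_block => //=; rewrite !upd_nth /=.
    by apply: Ij; rewrite /positive_noise wj.
  apply: halts_block_seq => //=; apply: halts_block => //=; rewrite !upd_nth /=.
  by apply: Ij; rewrite /positive_noise (negbTE wj).
- by exists 0%N, 0.
Qed.

Variables (tau : 'I_n) (r : nat).
Hypothesis rtau : (r = 2%N /\ tau = s) \/ (r = 3%N /\ tau = t).

Lemma nth_terminal (a b : nat) L :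
  nth 0%N [:: a, b, nat_of_ord s, nat_of_ord t & L] r = tau.
Proof. by case: rtau => -[-> ->]. Qed.

Variables (G : wgraph R n) (F : nat -> R) (l : seq ('I_n * 'I_n)).
Hypotheses (F_ge0 : forall a, 0 <= F a) (F_tau : F tau = 0).
Hypotheses (F_n : forall a, (n <= a)%N -> F a = 0) (lG : edge_list G l).
Let G' := star G F_ge0 F_tau.
Let B := (size l + n)%N.
Local Arguments nth : simpl nomatch.

Lemma residue_rcons l1 e a :
  residue tau F (rcons l1 e) a =
  if joins tau a e then 0 else residue tau F l1 a.
Proof. by rewrite /residue has_rcons; case: joins. Qed.

(** Each unordered pair is listed only once, so when the pass reaches an edge at [tau], the noise of
    the other endpoint is still in the array. *)
Lemma residue_fresh l1 l2 u v : l = l1 ++ (u, v) :: l2 ->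
  (u = tau -> residue tau F l1 v = F v) /\ (v = tau -> residue tau F l1 u = F u).
Proof.
move=> lE; have [ul l_edge _] := lG.
have [_ uvN] : 0 < G u v /\ (v, u) \notin l.
  by apply: l_edge; rewrite lE mem_cat mem_head orbT.
have uvl1 : (u, v) \notin l1.
  move: ul; rewrite lE cat_uniq => /and3P[_ /hasPn/(_ (u, v)) + _].
  by apply; exact: mem_head.
have vul1 : (v, u) \notin l1.
  by apply: contra uvN => vul1; rewrite lE mem_cat vul1.
split => [ut|vt]; rewrite /residue ifN// -all_predC; apply/allP => -[a b] abl1;
  rewrite /= /joins /=; apply/negP => /orP[]/andP[/eqP at_ /eqP/val_inj bv];
  by move: abl1; rewrite at_ bv -?ut -?vt; apply/negP.
Qed.

Lemma absorb_loopP a0 x0 w :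
  halts (absorb_loop r)
    (State (nregs (size l) 0%N B a0 0%N 0%N) (rregs x0 0) (nth 0%N (flat l))
       (real_array [seq G e.1 e.2 | e <- l] B F) w) (size l * 22).+1
    (fun st => exists a u v x y, st =
       State (nregs (size l) (size l) B a u v) (rregs x y) (nth 0%N (flat l))
         (real_array [seq G' e.1 e.2 | e <- l] B (residue tau F l)) w).
Proof.
(* After [j] iterations the first [j] edges carry their new weights and the others still the old
   ones. *)
pose ws j := [seq G' e.1 e.2 | e <- take j l] ++ [seq G e.1 e.2 | e <- drop j l].
pose I j st := exists a u v x y, st =
  State (nregs (size l) j B a u v) (rregs x y) (nth 0%N (flat l))
    (real_array (ws j) B (residue tau F (take j l))) w.
suff: halts (absorb_loop r)
    (State (nregs (size l) 0%N B a0 0%N 0%N) (rregs x0 0) (nth 0%N (flat l))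
       (real_array [seq G e.1 e.2 | e <- l] B F) w) (size l * 22).+1 (I (size l)).
  move=> h; apply: halts_weaken h _ _ => // _ [a [u [v [x [y ->]]]]].
  by exists a, u, v, x, y; rewrite /ws take_size drop_size cats0.
apply: (@halts_while _ _ _ I (size l) 21); last first.
- by move=> _ [a [u [v [x [y ->]]]]]; rewrite /= ltnn.
- move=> j _ jl [a [u0 [v0 [x [y ->]]]]]; split => //.
  have jB : (j < B)%N by rewrite /B; lia.
  have := take_nth (tau, tau) jl; have := drop_nth (tau, tau) jl.
  case: (nth _ l j) => u v dropE takeE.
  have lE : l = take j l ++ (u, v) :: drop j.+1 l by rewrite -dropE cat_take_drop.
  have jE : size (take j l) = j by rewrite size_take jl.
  have [ut vt] := residue_fresh lE.
  have flatu : nth 0%N (flat l) (j + j) = u.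
    by have := nth_flat1 (take j l) (u, v) (drop j.+1 l); rewrite -lE jE.
  have flatv : nth 0%N (flat l) (j + j + 1) = v.
    by have := nth_flat2 (take j l) (u, v) (drop j.+1 l); rewrite -lE jE.
  have wsj : nth 0 (ws j) j = G u v.
    by rewrite /ws dropE nth_cat size_map jE ltnn subnn.
  have wsS : set_nth 0 (ws j) j (star_weight G tau F u v) = ws j.+1.
    rewrite /ws dropE takeE map_rcons cat_rcons /=.
    have := set_nth_cat 0 (G u v) (star_weight G tau F u v)
      [seq G' e.1 e.2 | e <- take j l] [seq G e.1 e.2 | e <- drop j.+1 l].
    by rewrite size_map jE.
  have uv : u <> v.
    move=> uv; have [_ l_edge _] := lG.
    have [] : 0 < G u v /\ (v, u) \notin l.
      by apply: l_edge; rewrite lE mem_cat mem_head orbT.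
    by rewrite uv wt_irr ltxx.
  have IS (a' : nat) (x' y' w' : R) h : w' = star_weight G tau F u v ->
      (forall i, h i = if joins tau i (u, v) then 0 else residue tau F (take j l) i) ->
      I j.+1 (State (nregs (size l) (j + 1)%N B a' (nat_of_ord u) (nat_of_ord v))
        (rregs x' y')
        (nth 0%N (flat l)) (real_array (set_nth 0 (ws j) j w') B h) w).
    move=> -> hE; exists a', u, v, x', y'; rewrite addn1 wsS; congr State.
    by congr real_array; apply/funext => i; rewrite takeE residue_rcons hE.
  (* An edge away from [tau] is not written; viewing this as rewriting its old weight lets [IS]
     cover all branches. *)
  have wsj' : ws j = set_nth 0 (ws j) j (G u v).
    have := set_nth_cat 0 (G u v) (G u v)
      [seq G' e.1 e.2 | e <- take j l] [seq G e.1 e.2 | e <- drop j.+1 l].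
    by rewrite size_map jE /ws dropE.
  apply: halts_block_seq => //=; rewrite !upd_nth /= flatu flatv.
  apply: halts_if_eq_seq => //=; rewrite nth_terminal => utau.
    apply: halts_block_seq => //=; rewrite !upd_nth /=.
    rewrite real_array_hi real_array_lo// upd_real_array_lo// upd_real_array_hi wsj.
    move/val_inj in utau; rewrite ut//.
    have vtau : v <> tau by rewrite -utau => /esym.
    apply: halts_if_eq_seq => //=; rewrite nth_terminal => vtau'.
      by case: vtau; exact: val_inj.
    apply: halts_block => //=; rewrite !upd_nth /=.
    apply: IS => [|i]; first by rewrite /star_weight utau eqxx ifN ?addr0//; exact/eqP.
    rewrite /joins /= utau eqxx (introF eqP vtau) orbF updE eq_sym.
    by case: eqP.
  apply: halts_if_eq_seq => //=; rewrite nth_terminal => vtau.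
    apply: halts_block_seq => //=; rewrite !upd_nth /=.
    rewrite real_array_hi real_array_lo// upd_real_array_lo// upd_real_array_hi wsj.
    move/val_inj in vtau; rewrite vt//.
    have utau' : u <> tau by rewrite -vtau.
    apply: halts_block => //=; rewrite !upd_nth /=.
    apply: IS => [|i].
      by rewrite /star_weight vtau eqxx ifN ?addr0//; exact/eqP.
    rewrite /joins /= vtau eqxx (introF eqP utau') /= updE eq_sym.
    by case: eqP.
  apply: halts_block => //=; rewrite !upd_nth /= wsj'.
  have utau' : (u == tau) = false by apply/eqP => h; apply: utau; rewrite h.
  have vtau' : (v == tau) = false by apply/eqP => h; apply: vtau; rewrite h.
  apply: IS => [|i]; first by rewrite /star_weight utau' vtau' !addr0.
  by rewrite /joins /= utau' vtau'.
- exists a0, 0%N, 0%N, x0, 0; rewrite /ws take0 drop0 /=.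
  by congr State; congr real_array; apply/funext.
Qed.

Lemma residue_weight (v : 'I_n) :
  0 < residue tau F l v -> star_weight G tau F tau v = residue tau F l v.
Proof.
rewrite /residue; case: ifPn => [|nj Fv]; first by rewrite ltxx.
have Gv : G tau v = 0.
  apply/eqP; rewrite eq_le wt_ge0 andbT leNgt; apply: contra nj => Gv.
  have [_ _ /(_ _ _ Gv)[vl|vl]] := lG; apply/hasP; eexists; eauto;
    by rewrite /joins /= !eqxx ?orbT.
rewrite /star_weight Gv add0r eqxx.
by case: eqP => [->|]; rewrite ?F_tau addr0.
Qed.

Lemma append_loopP a0 u0 v0 x0 y0 w :
  halts (append_loop r)
    (State (nregs (size l) 0%N B a0 u0 v0) (rregs x0 y0) (nth 0%N (flat l))
       (real_array [seq G' e.1 e.2 | e <- l] B (residue tau F l)) w) (n * 12).+1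
    (fun st => exists a u v x y, let l' := l ++ new_edges tau F l (enum 'I_n) in
     st = State (nregs (size l') n B a u v) (rregs x y)
       (nth 0%N (flat l')) (nth 0 [seq G' e.1 e.2 | e <- l']) w).
Proof.
pose l_ j := l ++ new_edges tau F l (take j (enum 'I_n)).
(* At most one edge is appended per node, so appended weights stay below the base [B] and never hit
   unread noise. *)
have size_l_ j : (size (l_ j) <= size l + j)%N.
  rewrite size_cat leq_add2l size_map size_filter (leq_trans (count_size _ _))//.
  by rewrite size_take_min geq_minl.
pose I j st := exists a u v x y, st =
  State (nregs (size (l_ j)) j B a u v) (rregs x y) (nth 0%N (flat (l_ j)))
    (real_array [seq G' e.1 e.2 | e <- l_ j] B
       (fun i => if (i < j)%N then 0 else residue tau F l i)) w.
have l_n : l_ n = l ++ new_edges tau F l (enum 'I_n).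
  by rewrite /l_ -[X in take X](size_enum_ord n) take_size.
suff: halts (append_loop r)
    (State (nregs (size l) 0%N B a0 u0 v0) (rregs x0 y0) (nth 0%N (flat l))
       (real_array [seq G' e.1 e.2 | e <- l] B (residue tau F l)) w) (n * 12).+1
    (I n).
  move=> h; apply: halts_weaken h _ _ => // _ [a [u [v [x [y ->]]]]].
  exists a, u, v, x, y; rewrite -l_n /=; congr State.
  rewrite -(@real_array0 _ _ B) ?size_map//; congr real_array; apply/funext => i.
  case: ltnP => // ni; rewrite /residue F_n//; exact: if_same.
apply: (@halts_while _ _ _ I n 11); last first.
- by move=> _ [a [u [v [x [y ->]]]]]; rewrite /= ltnn.
- move=> j _ jn [a [u [v [x [y ->]]]]]; split => //.
  pose z : 'I_n := Ordinal jn.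
  have takeE : take j.+1 (enum 'I_n) = rcons (take j (enum 'I_n)) z.
    rewrite (take_nth z) ?size_enum_ord//; congr rcons.
    by apply/val_inj; rewrite /= nth_enum_ord.
  have lS : l_ j.+1 = if 0 < residue tau F l j then rcons (l_ j) (tau, z) else l_ j.
    rewrite /l_ /new_edges takeE filter_rcons /=; case: ifP => // _.
    by rewrite map_rcons rcons_cat.
  have lB : (size (l_ j) < B)%N by rewrite /B; have := size_l_ j; lia.
  apply: halts_block_seq => //=; rewrite !upd_nth /=.
  rewrite real_array_hi ltnn.
  apply: halts_if_seq => //= resj.
    apply: halts_block_seq => //=; rewrite !upd_nth /= nth_terminal.
    apply: halts_block => //=; rewrite !upd_nth /=.
    have flatE := set_nth_flat (l_ j) tau z; rewrite /= in flatE.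
    rewrite flatE upd_real_array_lo// upd_real_array_hi.
    exists (B + j)%N, (size (l_ j) + size (l_ j) + 1)%N, v, (residue tau F l j), y.
    rewrite lS resj size_rcons !addn1; congr State; congr real_array.
      have lj : size (l_ j) = size [seq G' e.1 e.2 | e <- l_ j] by rewrite size_map.
      rewrite map_rcons {1}lj set_nth_rcons; congr rcons.
      by rewrite /= residue_weight.
    apply/funext => i; rewrite updE ltnS.
    by case: (ltngtP i j).
  apply: halts_skip_seq; apply: halts_block => //=; rewrite !upd_nth /=.
  exists (B + j)%N, u, v, (residue tau F l j), y.
  rewrite lS (negbTE resj) addn1; congr State; congr real_array.
  apply/funext => i; rewrite ltnS; case: (ltngtP i j) => // ->.
  by apply/eqP; rewrite eq_le residue_ge0// leNgt resj.
- exists a0, u0, v0, x0, y0.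
  by rewrite /l_ take0 /new_edges /= cats0.
Qed.

End StarProgram.

Section AddStar.
Context {R : realType} {n : nat}.
Variables (s t : 'I_n) (sc : R).
Hypothesis sc_ge0 : 0 <= sc.
Implicit Types (w : nat -> R).

Lemma tape_noise_ge0 w a : 0 <= tape_noise s t sc w a.
Proof.
rewrite /tape_noise /positive_noise; case: ifP => // _; case: ifP => // wa.
by rewrite mulr_ge0// ltW.
Qed.

Lemma tape_noise_s w : tape_noise s t sc w s = 0.
Proof. by rewrite /tape_noise eqxx. Qed.

Lemma tape_noise_t w : tape_noise s t sc w t = 0.
Proof. by rewrite /tape_noise eqxx orbT. Qed.

(** The final state equals [init] of the new graph on a tape advanced by [n], which is what makes
    the two passes and the black box composable. *)
Lemma add_starP (r : nat) (tau : 'I_n) (G : wgraph R n) l w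
    (F_tau : tape_noise s t sc w tau = 0) :
  (r = 2%N /\ tau = s) \/ (r = 3%N /\ tau = t) -> edge_list G l ->
  let G' := star G (tape_noise_ge0 w) F_tau in
  exists l', [/\ edge_list G' l', (size l <= size l' <= size l + n)%N &
    halts (add_star sc r) (init G s t l w) (22 * (n + size l) + 23)
      (eq (init G' s t l' (fun k => w (n + k)%N)))].
Proof.
move=> rtau lG G'; pose F := tape_noise s t sc w.
exists (l ++ new_edges tau F l (enum 'I_n)); split.
- exact: edge_list_star.
- by rewrite size_cat leq_addr leq_add2l size_new_edges.
pose B := (size l + n)%N.
pose l' := l ++ new_edges tau F l (enum 'I_n).
apply: (@halts_weaken _ _ _
  (3 + ((n * 7).+1 + (5 + ((size l * 22).+1 + (1 + ((n * 12).+1 + 10)))))) _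
  (eq (init G' s t l' (fun k => w (n + k)%N)))).
- apply: halts_block_seq => //=.
  rewrite addKn -(nth_nseq_cat 0%N [:: n; size l; nat_of_ord s; nat_of_ord t] 6) /=.
  rewrite (_ : (fun=> 0) = nth (0 : R) [:: 0; 0; 0; 0]); last first.
    by apply/funext => i; rewrite (nth_nseq 0 4) if_same.
  rewrite -(@real_array0 _ [seq G e.1 e.2 | e <- l] B) ?size_map ?leq_addr//.
  rewrite !upd_nth /=.
  apply: halts_seq; first exact: sample_loopP.
  move=> _ [a [x ->]]; apply: halts_block_seq => //=; rewrite !upd_nth /=.
  rewrite addKn !upd_real_array_hi.
  rewrite (_ : upd (upd _ _ _) _ _ = F); last first.
    apply/funext => i; rewrite !updE /F /tape_noise; case: eqVneq => [->|it].
      by rewrite orbT.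
    by case: eqVneq => //= _; case: ltnP.
  apply: halts_seq; first exact: (absorb_loopP sc rtau (tape_noise_ge0 w) F_tau lG).
  move=> _ [a' [u [v [x' [y' ->]]]]]; apply: halts_block_seq => //=.
  rewrite !upd_nth addKn /=.
  apply: halts_seq; first apply: (append_loopP sc rtau (tape_noise_ge0 w) F_tau _ lG).
    by move=> i ni; rewrite /F /tape_noise ni !orbT.
  move=> _ [a'' [u' [v' [x'' [y'' ->]]]]]; apply: halts_block => //=.
  rewrite !upd_nth /=; congr State.
  + by rewrite -(nth_nseq_cat 0%N _ 6).
  + by apply/funext => i; rewrite (nth_nseq 0 4) if_same.
- by lia.
- by [].
Qed.

End AddStar.

(** * Cut values *)

Section Cuts.
Context {R : realType} {n : nat}.
Implicit Types (G : wgraph R n) (A B : {set 'I_n}) (s t : 'I_n).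

Lemma cut_valueE G A : cut_value G A = \sum_(u in A) \sum_(v in (~: A)%SET) G u v.
Proof.
rewrite /cut_value /edge_weight pair_big_dep /=.
rewrite [RHS]big_mkcond [LHS]big_mkcond /=; apply: eq_bigr => -[u v] _ /=.
rewrite !inE /=; case: (u \in A) => //=; case: (v \in A) => //=.
by case: ltP => // Guv; apply/eqP; rewrite eq_le wt_ge0 Guv.
Qed.

Lemma cut_value_star_in G (tau : 'I_n) (F : nat -> R)
    (F_ge0 : forall a, 0 <= F a) (F_tau : F tau = 0) A :
  tau \in A ->
  cut_value (star G F_ge0 F_tau) A =
  cut_value G A + \sum_(v in (~: A)%SET) F (nat_of_ord v).
Proof.
move=> tauA; rewrite !cut_valueE /= exchange_big /= [in RHS]exchange_big /=.
rewrite -big_split /=; apply: eq_bigr => v vA.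
under eq_bigr => u uA.
  rewrite /star_weight (_ : (v == tau) = false) ?addr0; last first.
    by apply/eqP => vt; move: vA; rewrite vt inE tauA.
  over.
rewrite big_split /=; congr (_ + _).
rewrite (bigD1 tau)//= eqxx big1 ?addr0// => u /andP[_ ut].
by rewrite (negbTE ut).
Qed.

Lemma cut_value_star_out G (tau : 'I_n) (F : nat -> R)
    (F_ge0 : forall a, 0 <= F a) (F_tau : F tau = 0) A :
  tau \notin A ->
  cut_value (star G F_ge0 F_tau) A =
  cut_value G A + \sum_(u in A) F (nat_of_ord u).
Proof.
move=> tauA; rewrite !cut_valueE -big_split /=; apply: eq_bigr => u uA.
under eq_bigr => v vA.
  rewrite /star_weight (_ : (u == tau) = false) ?addr0; last first.
    by apply/eqP => ut; move: tauA; rewrite -ut uA.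
  over.
rewrite big_split /=; congr (_ + _).
rewrite (bigD1 tau) ?inE//= eqxx big1 ?addr0// => v /andP[_ vt].
by rewrite (negbTE vt).
Qed.

(** Every ordered pair that contributes to the cut is listed in exactly one orientation. Splitting
    the sum by orientation and swapping the summation indices in one half gives one term per listed
    edge, counted when its endpoints are separated. *)
Lemma cut_value_edge_list G l A : edge_list G l ->
  cut_value G A =
  \sum_(e <- l) (if (e.1 \in A) != (e.2 \in A) then G e.1 e.2 else 0).
Proof.
move=> [ul l1 l2]; rewrite cut_valueE.
pose c (u v : 'I_n) : R := if (u \in A) && (v \notin A) then G u v else 0.
transitivity (\sum_u \sum_v c u v).
  rewrite big_mkcond; apply: eq_bigr => u _; rewrite /c; case: (u \in A) => /=.
    by rewrite big_mkcond; apply: eq_bigr => v _; rewrite inE.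
  by rewrite big1.
have cE u v : c u v = (if (u, v) \in l then c u v else 0) +
                      (if (v, u) \in l then c u v else 0).
  case: ifPn => uvl; first by have [_ /negbTE->] := l1 _ _ uvl; rewrite addr0.
  case: ifPn => vul; first by rewrite add0r.
  rewrite addr0 /c; case: ifP => // _; apply/eqP; rewrite eq_le wt_ge0 andbT leNgt.
  by apply/negP => /l2[]; apply/negP.
under eq_bigr do under eq_bigr do rewrite cE.
under eq_bigr do rewrite big_split /=.
rewrite big_split /= [X in _ + X]exchange_big /= -big_split /=.
under eq_bigr do rewrite -big_split /=.
rewrite pair_bigA /= [RHS]big_uniq //= [RHS]big_mkcond /=.
apply: eq_bigr => -[u v] _ /=; case: ifP => uvl; last by rewrite addr0.
rewrite /c [G v u]wt_sym.
by case: (u \in A); case: (v \in A); rewrite /= ?addr0 ?add0r.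
Qed.

Lemma st_cut_set1 s t : s != t -> is_st_cut s t [set s]%SET.
Proof. by move=> st; rewrite /is_st_cut !inE eqxx /= eq_sym. Qed.

Lemma min_cut_valueP G s t : s != t ->
  (exists2 A, is_st_cut s t A & cut_value G A = min_cut_value G s t) /\
  (forall A, is_st_cut s t A -> min_cut_value G s t <= cut_value G A).
Proof.
move=> st; rewrite /min_cut_value.
case: arg_minP => [|A Acut Amin]; first exact: st_cut_set1.
by split => //; exists A.
Qed.

Lemma is_min_st_cutP G s t A : s != t ->
  is_min_st_cut G s t A <->
  is_st_cut s t A /\ (forall B, is_st_cut s t B -> cut_value G A <= cut_value G B).
Proof.
move=> st; have [[A0 A0cut A0min] min_le] := min_cut_valueP G st.
split => [[Acut ->]|[Acut Amin]]; split => //.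
by apply/eqP; rewrite eq_le min_le// -A0min Amin.
Qed.

End Cuts.

(** * An exact algorithm by exhaustive search *)

Definition bits (n k : nat) : {set 'I_n} := [set v : 'I_n | odd (k %/ 2 ^ v)]%SET.

(** Induction peels off the lowest bit: [P 0] is the parity, and halving shifts the remaining
    bits. *)
Lemma exists_bits n (P : nat -> bool) :
  exists2 k, (k < 2 ^ n)%N & forall v, (v < n)%N -> odd (k %/ 2 ^ v) = P v.
Proof.
elim: n P => [|n IHn] P; first by exists 0%N.
have [k kn kP] := IHn (fun v => P v.+1).
exists (P 0%N + k * 2)%N; first by rewrite expnS; case: (P 0%N) => /=; lia.
move=> [_|v]; first by rewrite expn0 divn1 oddD oddM andbF addbF oddb.
rewrite ltnS => vn; rewrite expnS divnMA divnDMl// (_ : (P 0%N %/ 2 = 0)%N) ?add0n ?kP//.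
by case: (P 0%N).
Qed.

Lemma bits_surj n (A : {set 'I_n}) : exists2 k, (k < 2 ^ n)%N & bits n k = A.
Proof.
have [k kn kP] := exists_bits n
  (fun v => if insub v is Some u then u \in A else false).
exists k => //; apply/setP => v; rewrite inE kP//.
by case: insubP => [u _ /val_inj->|]; rewrite ?ltn_ord.
Qed.

Section BruteForce.
Context {R : realType}.

(* Register 4 is the loop counter, 5 the base of the bit vector, 6 and 7 the
   constants 1 and 2, 8 holds 2 ^ n, 9 the current and 10 the best subset of the
   nodes (as binary numbers), 11 tells whether some cut was seen; real registers
   0 and 1 are the best and the current cut value. *)
Definition unpack_loop : prog R :=
  While (NLt 4 0)
    (block [:: NOp R Div 13 12 7; NOp R Mul 14 13 7; NOp R Defs.Sub 14 12 14;
               NOp R Div 12 12 7; NOp R Add 13 5 4; NStore R 13 14;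
               NOp R Add 4 4 6]).

Definition eval_loop : prog R :=
  While (NLt 4 1)
    (Seq (block [:: NOp R Add 13 4 4; NLoad R 12 13; NOp R Add 12 12 5;
                    NLoad R 12 12; NOp R Add 13 13 6; NLoad R 14 13;
                    NOp R Add 14 14 5; NLoad R 14 14; RLoad R 2 4])
    (Seq (if_eq 12 14 (block [:: RSet 2 0]))
         (block [:: ROp R Add 1 1 2; NOp R Add 4 4 6]))).

(** Registers are copied by clearing the target and adding the source, as there is no move
    instruction. *)
Definition update_best : prog R :=
  block [:: NSet R 10 0; NOp R Add 10 10 9; NSet R 11 1; RSet 0 0;
            ROp R Add 0 0 1].

(** Registers 12 and 13 receive the bits of [s] and [t]; the single test that the bit of [t] is
    smaller recognizes an s-t cut. The flag in register 11 replaces an infinite initial best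
    value. *)
Definition search_loop : prog R :=
  While (NLt 9 8)
    (Seq (block [:: NSet R 4 0; NSet R 12 0; NOp R Add 12 12 9])
    (Seq unpack_loop
    (Seq (block [:: NOp R Add 12 5 2; NLoad R 12 12; NOp R Add 13 5 3;
                    NLoad R 13 13; NSet R 4 0; RSet 1 0])
    (Seq (If (NLt 13 12)
            (Seq eval_loop
                 (If (NLt 11 6) update_best (If (RLt 1 0) update_best Skip)))
            Skip)
         (block [:: NOp R Add 9 9 6]))))).

Definition power_loop : prog R :=
  While (NLt 4 0) (block [:: NOp R Mul 8 8 7; NOp R Add 4 4 6]).

(** During the search the bit vector lies just past the 2m cells of the edge list. The final
    unpacking uses base 0, where the output is read, and may overwrite the edges. *)
Definition brute_force : prog R :=
  Seq (block [:: NSet R 6 1; NSet R 7 2; NOp R Add 5 1 1; NSet R 8 1])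
  (Seq power_loop
  (Seq search_loop
  (Seq (block [:: NSet R 5 0; NSet R 4 0; NSet R 12 0; NOp R Add 12 12 10])
       unpack_loop))).

Variables (n : nat) (G : wgraph R n) (s t : 'I_n) (l : seq ('I_n * 'I_n)).
Hypotheses (st_neq : s != t) (lG : edge_list G l).
Local Notation m := (size l).
Local Notation regs i B P k best fnd x a b :=
  (nth 0%N [:: n; m; nat_of_ord s; nat_of_ord t; i; B; 1%N; 2%N; P; k; best;
               fnd; x; a; b]).

Definition unpacked (B k : nat) (mN : nat -> nat) (a : nat) : nat :=
  if (B <= a < B + n)%N then nat_of_bool (odd (k %/ 2 ^ (a - B))) else mN a.

Lemma unpacked_bit B k mN (v : 'I_n) :
  unpacked B k mN (B + v)%N = (v \in bits n k).
Proof. by rewrite /unpacked leq_addr ltn_add2l ltn_ord addKn inE. Qed.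

Lemma unpack_loopP B P k best fnd x a b X mN mX w :
  halts unpack_loop (State (regs 0%N B P k best fnd x a b) X mN mX w) (n * 8).+1
    (fun st => exists x' a' b', st =
       State (regs n B P k best fnd x' a' b') X (unpacked B x mN) mX w).
Proof.
pose I j st := exists a' b', st =
  State (regs j B P k best fnd (x %/ 2 ^ j)%N a' b') X
    (fun a => if (B <= a < B + j)%N then nat_of_bool (odd (x %/ 2 ^ (a - B)))
              else mN a) mX w.
apply: (@halts_weaken _ _ _ (n * 8).+1 _ (I n)) => //; last first.
  by move=> _ [a' [b' ->]]; eexists _, _, _; reflexivity.
apply: (@halts_while _ _ _ I n 7); last first.
- by move=> _ [a' [b' ->]]; rewrite /= ltnn.
- move=> j _ jn [a' [b' ->]]; split => //.
  apply: halts_block => //=; rewrite !upd_nth /=.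
  (* The low bit is formed as y - (y / 2) * 2, as there is no remainder instruction. *)
  exists (B + j)%N, (x %/ 2 ^ j - x %/ 2 ^ j %/ 2 * 2)%N.
  rewrite expnSr divnMA addn1; congr State.
  apply/funext => c; rewrite updE; case: eqVneq => [->|cj].
    rewrite leq_addr ltn_add2l ltnSn addKn /= divn2 muln2.
    by have := odd_double_half (x %/ 2 ^ j); lia.
  by rewrite (_ : (B <= c < B + j.+1)%N = (B <= c < B + j)%N)//; lia.
- exists a, b; rewrite expn0 divn1; congr State; apply/funext => c.
  by rewrite ifF//; lia.
Qed.

Lemma eval_loopP P k best fnd x a b y z mN w :
  (forall i, (i < m + m)%N -> mN i = nth 0%N (flat l) i) ->
  (forall v : 'I_n, mN (m + m + v)%N = (v \in bits n k)) ->
  halts eval_loop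
    (State (regs 0%N (m + m)%N P k best fnd x a b) (nth 0 [:: y; 0; z]) mN
       (nth 0 [seq G e.1 e.2 | e <- l]) w) (m * 15).+1
    (fun st => exists x' a' b' z', st =
       State (regs m (m + m)%N P k best fnd x' a' b')
         (nth 0 [:: y; cut_value G (bits n k); z']) mN
         (nth 0 [seq G e.1 e.2 | e <- l]) w).
Proof.
move=> mN_lo mN_hi.
pose c (e : 'I_n * 'I_n) : R :=
  if (e.1 \in bits n k) != (e.2 \in bits n k) then G e.1 e.2 else 0.
pose I j st := exists x' a' b' z', st =
  State (regs j (m + m)%N P k best fnd x' a' b')
    (nth 0 [:: y; \sum_(e <- take j l) c e; z']) mN
    (nth 0 [seq G e.1 e.2 | e <- l]) w.
apply: (@halts_weaken _ _ _ (m * 15).+1 _ (I m)) => //; last first.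
  move=> _ [x' [a' [b' [z' ->]]]]; exists x', a', b', z'.
  by rewrite take_size (cut_value_edge_list _ lG).
apply: (@halts_while _ _ _ I m 14); last first.
- by move=> _ [x' [a' [b' [z' ->]]]]; rewrite /= ltnn.
- move=> j _ jl [x' [a' [b' [z' ->]]]]; split => //.
  have := take_nth (s, s) jl; have := drop_nth (s, s) jl.
  case: (nth _ l j) => u v dropE takeE.
  have lE : l = take j l ++ (u, v) :: drop j.+1 l by rewrite -dropE cat_take_drop.
  have jE : size (take j l) = j by rewrite size_take jl.
  have flatu : nth 0%N (flat l) (j + j) = u.
    by have := nth_flat1 (take j l) (u, v) (drop j.+1 l); rewrite -lE jE.
  have flatv : nth 0%N (flat l) (j + j + 1) = v.
    by have := nth_flat2 (take j l) (u, v) (drop j.+1 l); rewrite -lE jE.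
  have wj : nth 0 [seq G e.1 e.2 | e <- l] j = G u v.
    by rewrite lE map_cat nth_cat size_map jE ltnn subnn.
  apply: halts_block_seq => //=; rewrite !upd_nth /=.
  rewrite (mN_lo (j + j)%N); last by lia.
  rewrite (mN_lo (j + j + 1)%N); last by lia.
  rewrite flatu flatv wj [(u + _)%N]addnC [(v + _)%N]addnC !mN_hi.
  have sumE : \sum_(e <- take j.+1 l) c e = \sum_(e <- take j l) c e + c (u, v).
    by rewrite takeE -cats1 big_cat big_seq1.
  apply: halts_if_eq_seq => //= uv.
    apply: halts_block_seq => //=; apply: halts_block => //=; rewrite !upd_nth /=.
    do 4 eexists; rewrite sumE addn1 /c /=.
    by rewrite (_ : (u \in _) != _ = false)//; move: uv; do 2 case: (_ \in _).
  apply: halts_block => //=; rewrite !upd_nth /=.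
  do 4 eexists; rewrite sumE addn1 /c /=.
  by rewrite (_ : (u \in _) != _ = true)//; move: uv; do 2 case: (_ \in _).
- by exists x, a, b, z; rewrite take0 big_nil.
Qed.

Definition best_of (j best : nat) (fnd : bool) (y : R) : Prop :=
  if fnd then
    [/\ is_st_cut s t (bits n best), y = cut_value G (bits n best) &
        forall k, (k < j)%N -> is_st_cut s t (bits n k) ->
          y <= cut_value G (bits n k)]
  else forall k, (k < j)%N -> ~~ is_st_cut s t (bits n k).

Lemma best_of_skip j best fnd y : ~~ is_st_cut s t (bits n j) ->
  best_of j best fnd y -> best_of j.+1 best fnd y.
Proof.
move=> jN; case: fnd => /= [[b1 b2 b3]|b1]; [split => //|];
  move=> k; rewrite ltnS leq_eqVlt => /orP[/eqP->|]; do ?[by rewrite (negbTE jN)|by []];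
  [exact: b3|exact: b1].
Qed.

Lemma best_of_update j best (fnd : bool) y : is_st_cut s t (bits n j) ->
  (fnd -> cut_value G (bits n j) < y) ->
  best_of j best fnd y -> best_of j.+1 j true (cut_value G (bits n j)).
Proof.
move=> jc; case: fnd => /= [/(_ isT) jy [b1 b2 b3]|_ b1]; split => // k;
  rewrite ltnS leq_eqVlt => /orP[/eqP->//|kj] kc.
  by rewrite (le_trans (ltW jy))// b3.
by rewrite (negbTE (b1 _ kj)) in kc.
Qed.

Lemma best_of_keep j best y : ~~ (cut_value G (bits n j) < y) ->
  best_of j best true y -> best_of j.+1 best true y.
Proof.
move=> jy [b1 b2 b3]; split => // k; rewrite ltnS leq_eqVlt => /orP[/eqP->|kj] kc.
  by rewrite leNgt.
exact: b3.
Qed.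

Definition search_inv w j st := exists i best (fnd : bool) x a b y z z' mN,
  [/\ st = State (regs i (m + m)%N (2 ^ n)%N j best (nat_of_bool fnd) x a b)
         (nth 0 [:: y; z; z']) mN (nth 0 [seq G e.1 e.2 | e <- l]) w,
      forall i, (i < m + m)%N -> mN i = nth 0%N (flat l) i
    & best_of j best fnd y].

Lemma search_loopP st w : search_inv w 0 st ->
  halts search_loop st (2 ^ n * (n * 8 + m * 15 + 21).+1).+1 (search_inv w (2 ^ n)%N).
Proof.
move=> I0; apply: (@halts_while _ _ _ (search_inv w) (2 ^ n)%N) => //; last first.
  by move=> _ [i [best [fnd [x [a [b [y [z [z' [mN [-> _ _]]]]]]]]]]]; rewrite /= ltnn.
move=> j _ jn [i [best [fnd [x [a [b [y [z [z' [mN [-> mN_lo best_j]]]]]]]]]]].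
split => //.
apply: (@halts_weaken _ _ _
  (3 + ((n * 8).+1 + (6 + ((m * 15).+1 + 8).+1)))); last 2 first.
- by lia.
- by move=> st'; exact.
apply: halts_block_seq => //=; rewrite addKn !upd_nth /= add0n.
apply: halts_seq; first exact: unpack_loopP.
move=> _ [x1 [a1 [b1 ->]]].
apply: halts_block_seq => //=; rewrite addKn !upd_nth /= !unpacked_bit.
pose mN' := unpacked (m + m) j mN.
have mN'_lo i' : (i' < m + m)%N -> mN' i' = nth 0%N (flat l) i'.
  by move=> im; rewrite /mN' /unpacked ifF ?mN_lo//; lia.
have cutE : is_st_cut s t (bits n j) = (s \in bits n j) && (t \notin bits n j).
  by rewrite /is_st_cut finset.in_setC.
apply: halts_if_seq => //= cut_j.
  have jcut : is_st_cut s t (bits n j).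
    by rewrite cutE; move: cut_j; do 2 case: (_ \in _).
  apply: halts_seqA; apply: halts_seq.
    by apply: eval_loopP => // v; exact: unpacked_bit.
  move=> _ [x2 [a2 [b2 [z2 ->]]]].
  (* Shared by the two ways of accepting a cut: it is the first one seen, or it is strictly
     better. *)
  have upd_best : (fnd -> cut_value G (bits n j) < y) ->
    halts (Seq update_best (block [:: NOp R Add 9 9 6]))
      (State (regs m (m + m)%N (2 ^ n)%N j best (nat_of_bool fnd) x2 a2 b2)
         (nth 0 [:: y; cut_value G (bits n j); z2]) mN'
         (nth 0 [seq G e.1 e.2 | e <- l]) w) 6 (search_inv w j.+1).
    move=> better; apply: halts_block_seq => //=; apply: halts_block => //=.
    rewrite !upd_nth /= add0n add0r addn1.
    exists m, j, true, x2, a2, b2, (cut_value G (bits n j)),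
      (cut_value G (bits n j)), z2, mN'.
    by split => //; exact: best_of_update best_j.
  apply: halts_if_seq => //= fnd0.
    apply: halts_weaken (upd_best _) _ _ => //.
    by move: fnd0; case: (fnd).
  have fnd1 : fnd by move: fnd0; case: (fnd).
  apply: halts_if_seq => //= better; first exact: upd_best.
  apply: halts_skip_seq; apply: halts_block => //=; rewrite !upd_nth /= addn1.
  exists m, best, fnd, x2, a2, b2, y, (cut_value G (bits n j)), z2, mN'.
  by split => //; move: best_j; rewrite fnd1; exact: best_of_keep.
apply: halts_skip_seq; apply: halts_block => //=; rewrite !upd_nth /= addn1.
do 10 eexists; split; [reflexivity|exact: mN'_lo|].
apply: best_of_skip best_j; rewrite cutE.
by move: cut_j; do 2 case: (_ \in _).
Qed.

Lemma power_loopP mN mX w :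
  halts power_loop
    (State (regs 0%N (m + m)%N 1%N 0%N 0%N 0%N 0%N 0%N 0%N) (nth 0 [:: 0; 0; 0]) mN mX w)
    (n * 3).+1
    (eq (State (regs n (m + m)%N (2 ^ n)%N 0%N 0%N 0%N 0%N 0%N 0%N)
           (nth 0 [:: 0; 0; 0]) mN mX w)).
Proof.
apply: (@halts_while _ _ _ (fun j => eq (State
  (regs j (m + m)%N (2 ^ j)%N 0%N 0%N 0%N 0%N 0%N 0%N)
  (nth 0 [:: 0; 0; 0]) mN mX w)) n 2) => //.
- move=> j _ jn <-; split => //; apply: halts_block => //=.
  by rewrite !upd_nth /= addn1 expnSr.
- by move=> _ <-; rewrite /= ltnn.
Qed.

Lemma brute_force_correct w :
  exists A, returns brute_force G s t l w A /\ is_min_st_cut G s t A.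
Proof.
suff [c [k [st [e _ [A [Ast Amin]]]]]] : exists c,
    halts brute_force (init G s t l w) c
      (fun st => exists A, cut_of_state n st = A /\ is_min_st_cut G s t A).
  by exists A; split => //; exists k, st.
exists (4 + ((n * 3).+1 + ((2 ^ n * (n * 8 + m * 15 + 21).+1).+1 + (4 + (n * 8).+1))))%N.
apply: halts_block_seq => //=; rewrite addKn.
rewrite -(nth_nseq_cat 0%N [:: n; size l; nat_of_ord s; nat_of_ord t] 11) /=.
rewrite (_ : (fun=> 0) = nth (0 : R) [:: 0; 0; 0]); last first.
  by apply/funext => i; rewrite (nth_nseq 0 3) if_same.
rewrite !upd_nth /=.
apply: halts_seq; first exact: power_loopP.
move=> _ <-; apply: halts_seq; first apply: (@search_loopP _ w).
  exists n, 0%N, false, 0%N, 0%N, 0%N, 0, 0, 0, (nth 0%N (flat l)).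
  by split.
move=> _ [i [best [fnd [x [a [b [y [z [z' [mN [-> _ best_n]]]]]]]]]]].
apply: halts_block_seq => //=; rewrite addKn !upd_nth /= add0n.
apply: halts_weaken (unpack_loopP _ _ _ _ _ _ _ _ _ _ _ _) _ _ => //.
move=> _ [x' [a' [b' ->]]]; exists (bits n best); split.
  apply/setP => v; rewrite inE /= -{1}[nat_of_ord v]add0n unpacked_bit.
  by case: (_ \in _).
apply/is_min_st_cutP => //.
case: fnd best_n => /= [[bc yE bmin]|none].
  split => // A Acut; have [k kn kA] := bits_surj A.
  by rewrite -yE -kA bmin// kA.
have [k kn kA] := bits_surj [set s]%SET.
by have := none _ kn; rewrite kA st_cut_set1.
Qed.

End BruteForce.

Lemma brute_force_solves (R : realType) : solves_min_st_cut (@brute_force R).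
Proof.
by move=> n G s t l [st lG] w; exact: brute_force_correct.
Qed.

(** * Measurability of the output *)

Section Run.
Context {R : realType}.
Implicit Types (p q : prog R) (st : state R).

(** Part of an interpreter with fuel: each fixed fuel gives a measurable function of the state, and
    halting becomes a countable union over fuels. [j] bounds the tests of one loop; [run] starts
    every loop it enters with its full fuel. *)
Fixpoint loop (b : test) (body : state R -> bool * state R) (j : nat) st :
    bool * state R :=
  if j is j'.+1 then
    if eval_test b st then
      let r := body st in
      let r' := loop b body j' r.2 in (r.1 && r'.1, r'.2)
    else (true, st)
  else (false, st).

(* The Boolean tells whether the fuel [f] sufficed. *)
Fixpoint run (f : nat) p st : bool * state R :=
  match p with
  | Skip => (true, st)
  | Do i => (true, exec_instr i st)
  | Seq p1 p2 =>
      let r := run f p1 st in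
      let r' := run f p2 r.2 in (r.1 && r'.1, r'.2)
  | If b p1 p2 => if eval_test b st then run f p1 st else run f p2 st
  | While b p1 => loop b (run f p1) f st
  end.

Lemma run_sound f p st : (run f p st).1 -> exists k, exec p st k (run f p st).2.
Proof.
elim: p st => [|i|p IHp q IHq|b p IHp q IHq|b p IHp] st.
- by exists 0%N; exact: exec_skip.
- by exists 1%N; exact: exec_do.
- move=> /= /andP[/IHp[k ek] /IHq[l el]].
  by exists (k + l)%N; exact: exec_seq ek el.
- rewrite /=; case: ifPn => bt.
    by move=> /IHp[k ek]; exists k.+1; exact: exec_if_true.
  by move=> /IHq[k ek]; exists k.+1; exact: exec_if_false.
- rewrite /=; elim: {2 4}f st => //= j IHj st; case: ifPn => /= bt.
    move=> /andP[/IHp[k ek] /IHj[l el]].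
    by exists (k + l).+1; exact: exec_while_true bt ek el.
  by exists 1%N; exact: exec_while_false.
Qed.

(** More fuel changes both the number of iterations allowed and the loop body, so both vary here. *)
Lemma loop_mono b (body body' : state R -> bool * state R) j j' st :
  (forall st, (body st).1 -> body' st = body st) -> (j <= j')%N ->
  (loop b body j st).1 -> loop b body' j' st = loop b body j st.
Proof.
move=> bb'; elim: j j' st => // j IHj [//|j'] st jj' /=.
by case: ifPn => //= bt /andP[/bb'-> lp]; rewrite IHj.
Qed.

Lemma run_mono f f' p st : (f <= f')%N -> (run f p st).1 ->
  run f' p st = run f p st.
Proof.
suff H p' st' g : (run g p' st').1 -> run g.+1 p' st' = run g p' st'.
  move=> /subnK <-; elim: (f' - f)%N => //= d IHd r; rewrite addSn H IHd//.
elim: p' st' => [//|//|p1 IHp q IHq|b p1 IHp q IHq|b p1 IHp] st'.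
- by move=> /= /andP[r1 r2]; rewrite IHp ?IHq.
- by rewrite /=; case: ifPn => _ r; [exact: IHp|exact: IHq].
- by apply: loop_mono.
Qed.

Lemma run_complete p st k st' : exec p st k st' -> exists f, run f p st = (true, st').
Proof.
elim=> {p st k st'} [st|i st|p q st st1 st2 k l _ [f fE] _ [g gE]|
    b p q st st1 k bt _ [f fE]|b p q st st1 k bt _ [f fE]|
    b p st st1 st2 k l bt _ [f fE] _ [g gE]|b p st bt].
- by exists 0%N.
- by exists 0%N.
- exists (maxn f g) => /=.
  rewrite (@run_mono f) ?leq_maxl ?fE// (@run_mono g) ?leq_maxr ?gE//.
- by exists f; rewrite /= bt.
- by exists f; rewrite /= (negbTE bt).
- exists (maxn f g).+1 => /=; rewrite bt.
  rewrite (@run_mono f) ?fE//=; last by rewrite leqW// leq_maxl.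
  have gE' : run (maxn f g) (While b p) st1 = (true, st2).
    by rewrite (@run_mono g) ?gE// leq_maxr.
  have H st0 : (run (maxn f g) p st0).1 ->
    run (maxn f g).+1 p st0 = run (maxn f g) p st0 by exact: run_mono.
  by rewrite (loop_mono (j := maxn f g) H)//; move: gE' => /= ->.
- by exists 1%N; rewrite /= (negbTE bt).
Qed.

(** Determinism is inherited from [run] being a function: two complete runs agree at the larger
    fuel. *)
Lemma exec_det p st k st1 l st2 :
  exec p st k st1 -> exec p st l st2 -> st1 = st2.
Proof.
move=> /run_complete[f fE] /run_complete[g gE].
have := @run_mono f (maxn f g) p st; rewrite leq_maxl fE => /(_ isT isT).
have := @run_mono g (maxn f g) p st; rewrite leq_maxr gE => /(_ isT isT).
by move=> -> [].
Qed.

Lemma returns_det p n (G : wgraph R n) s t l w A B :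
  returns p G s t l w A -> returns p G s t l w B -> A = B.
Proof.
by move=> [k [st1 [e1 <-]]] [k' [st2 [e2 <-]]]; rewrite (exec_det e1 e2).
Qed.

End Run.

(** * Measurable dependence of a run on the randomness *)

Section MeasurableRun.
Context {R : realType} {d : measure_display} {T : measurableType d}.
Local Open Scope classical_set_scope.

(** Inversion is continuous off 0, and the convention that 0 inverts to 0 is treated as a separate
    case. *)
Lemma measurable_inv : measurable_fun [set: R] (@GRing.inv R).
Proof.
rewrite (_ : GRing.inv = fun x : R => if x == 0 then 0 else x^-1); last first.
  by apply/funext => x; case: eqVneq => // ->; rewrite invr0.
have m0 : measurable [set x : R | x != 0].
  rewrite (_ : mkset _ = ~` [set 0]); first exact: measurableC.
  by apply/seteqP; split => x /= /eqP.
apply: measurable_fun_if => //.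
- apply: (measurable_fun_bool false); rewrite setTI.
  rewrite (_ : _ @^-1` _ = [set x : R | x != 0])//.
  by apply/seteqP; split => x /=; case: eqP.
- rewrite setTI (_ : _ @^-1` _ = [set x : R | x != 0]); last first.
    by apply/seteqP; split => x /=; case: eqP.
  apply: open_continuous_measurable_fun; last first.
    by move=> x; rewrite inE /= => x0; exact: inv_continuous.
  rewrite (_ : mkset _ = ~` [set 0]); first exact/closed_openC/closed_eq.
  by apply/seteqP; split => x /= /eqP.
Qed.

(** The index takes countably many values, so the preimage splits along them. This handles indirect
    addressing, where the cell read or written is itself random. *)
Lemma measurable_select {d' : measure_display} {U : measurableType d'}
    (g : T -> nat) (f : nat -> T -> U) :
  measurable_fun setT g -> (forall i, measurable_fun setT (f i)) ->
  measurable_fun setT (fun x => f (g x) x).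
Proof.
move=> mg mf _ Y mY; rewrite setTI.
rewrite (_ : _ @^-1` Y = \bigcup_i (g @^-1` [set i] `&` f i @^-1` Y)).
  apply: bigcup_measurable => i _; apply: measurableI.
    by rewrite -[X in measurable X]setTI; exact: mg.
  by rewrite -[X in measurable X]setTI; exact: mf.
by apply/seteqP; split => [x fY|x [i _ [/= <-]]//]; exists (g x).
Qed.

(** Measurability is required cell by cell, which avoids putting a sigma-algebra on machine
    states. *)
Definition measurable_state (S : T -> state R) : Prop :=
  [/\ forall i, measurable_fun setT (fun x => nreg (S x) i),
      forall i, measurable_fun setT (fun x => rreg (S x) i),
      forall i, measurable_fun setT (fun x => nmem (S x) i),
      forall i, measurable_fun setT (fun x => rmem (S x) i)
    & forall i, measurable_fun setT (fun x => tape (S x) i)].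

Lemma measurable_nat2 {d' : measure_display} {U : measurableType d'}
    (h : nat -> nat -> U) (f g : T -> nat) :
  measurable_fun setT f -> measurable_fun setT g ->
  measurable_fun setT (fun x => h (f x) (g x)).
Proof.
move=> mf mg; apply: (measurable_select (f := fun i x => h i (g x))) => // i.
exact: (measurable_select (f := fun j _ => h i j)).
Qed.

Lemma measurable_upd {d' : measure_display} {U : measurableType d'}
    (f : T -> nat -> U) (a : T -> nat) (v : T -> U) i :
  (forall i, measurable_fun setT (fun x => f x i)) ->
  measurable_fun setT a -> measurable_fun setT v ->
  measurable_fun setT (fun x => upd (f x) (a x) (v x) i).
Proof.
move=> mf ma mv.
apply: (measurable_select (f := fun k x => if i == k then v x else f x i)) => // k.
by case: eqP.
Qed.

Lemma measurable_real_arith o (f g : T -> R) :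
  measurable_fun setT f -> measurable_fun setT g ->
  measurable_fun setT (fun x => real_arith o (f x) (g x)).
Proof.
move=> mf mg; case: o => /=.
- exact: measurable_funD.
- exact: measurable_funB.
- exact: measurable_funM.
- by apply: measurable_funM => //; apply: measurableT_comp => //; exact: measurable_inv.
Qed.

Lemma measurable_exec_instr i S : measurable_state S ->
  measurable_state (fun x => exec_instr i (S x)).
Proof.
case=> mN mX mmN mmX mw.
have stE x : S x = State (nreg (S x)) (rreg (S x)) (nmem (S x)) (rmem (S x)) (tape (S x)).
  by case: (S x).
under eq_fun do rewrite stE.
case: i => /= *; split => //= j; do ?[exact: measurable_upd|apply: measurable_upd => //].
- exact: measurable_nat2.
- exact: (measurable_select (f := fun k x => nmem (S x) k)).
- exact: measurable_real_arith.
- exact: (measurable_select (f := fun k x => rmem (S x) k)).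
Qed.

Lemma measurable_eval_test b S : measurable_state S ->
  measurable_fun setT (fun x => eval_test b (S x)).
Proof.
case=> mN mX _ _ _; case: b => i j /=; first exact: measurable_fun_ltn.
exact: measurable_fun_ltr.
Qed.

Definition measurable_result (r : T -> bool * state R) : Prop :=
  measurable_fun setT (fun x => (r x).1) /\ measurable_state (fun x => (r x).2).

Lemma measurable_result_if (b : T -> bool) r r' :
  measurable_fun setT b -> measurable_result r -> measurable_result r' ->
  measurable_result (fun x => if b x then r x else r' x).
Proof.
move=> mb [m1 [mN mX mmN mmX mw]] [m1' [mN' mX' mmN' mmX' mw']].
have mif (d' : measure_display) (U : measurableType d') (h : bool * state R -> U) :
    measurable_fun setT (fun x => h (r x)) -> measurable_fun setT (fun x => h (r' x)) ->
    measurable_fun setT (fun x => h (if b x then r x else r' x)).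
  move=> mr mr'; rewrite (_ : (fun _ => _) = fun x => if b x then h (r x) else h (r' x)).
    exact: measurable_fun_ifT.
  by apply/funext => x; case: (b x).
split; [exact: (mif _ _ fst)|split => i].
- exact: (mif _ _ (fun c => nreg c.2 i)).
- exact: (mif _ _ (fun c => rreg c.2 i)).
- exact: (mif _ _ (fun c => nmem c.2 i)).
- exact: (mif _ _ (fun c => rmem c.2 i)).
- exact: (mif _ _ (fun c => tape c.2 i)).
Qed.

Lemma measurable_result_seq (r : T -> bool * state R) (f : state R -> bool * state R) :
  (forall S, measurable_state S -> measurable_result (fun x => f (S x))) ->
  measurable_result r ->
  measurable_result (fun x => ((r x).1 && (f (r x).2).1, (f (r x).2).2)).
Proof.
move=> mf [m1 m2]; have [m1' m2'] := mf _ m2; split => //=.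
exact: measurable_and.
Qed.

Lemma measurable_run f p S : measurable_state S ->
  measurable_result (fun x => run f p (S x)).
Proof.
elim: p S => [|i|p IHp q IHq|b p IHp q IHq|b p IHp] S mS /=.
- by split.
- by split => //; exact: measurable_exec_instr.
- by apply: (@measurable_result_seq _ (run f q)) => //; exact: IHp.
- by apply: measurable_result_if; [exact: measurable_eval_test|exact: IHp|exact: IHq].
- elim: {2}f S mS => [|j IHj] S mS /=; first by split.
  apply: measurable_result_if; first exact: measurable_eval_test.
    by apply: (@measurable_result_seq _ (loop b (run f p) j)) => //; exact: IHp.
  by split.
Qed.

End MeasurableRun.

Section MeasurableOutput.
Local Open Scope classical_set_scope.

Lemma measurable_output_event (R : realType) (d : measure_display)
    (Omega : measurableType d) (Pr : probability Omega R)
    (xi : nat -> {RV Pr >-> R}) (p : prog R) (n : nat) (G : wgraph R n)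
    (s t : 'I_n) (l : seq ('I_n * 'I_n)) (O : {set {set 'I_n}}) :
  measurable (output_event xi p G s t l O).
Proof.
pose S omega := init G s t l (fun i => xi i omega).
have mS : measurable_state S by split => //= i; exact: measurable_funP.
pose r f omega := run f p (S omega).
(* A union over all fuels and the finitely many outputs; completeness and soundness of [run] give
   the two inclusions. *)
rewrite (_ : output_event _ _ _ _ _ _ _ = \bigcup_f \bigcup_(A in [set A | A \in O])
  [set omega | (r f omega).1 && (cut_of_state n (r f omega).2 == A)])%classic; last first.
  apply/seteqP; split => omega.
    move=> [A AO [k [st [/run_complete[f fE] stA]]]]; exists f => //; exists A => //=.
    by rewrite /r fE /= stA eqxx.
  move=> [f _ [A AO /= /andP[/run_sound[k e] /eqP stA]]].
  by exists A => //; exists k; eexists; split; [exact: e|].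
apply: bigcup_measurable => f _; apply: fin_bigcup_measurable => // A _.
have [m1 [_ _ mmN _ _]] := measurable_run f p mS.
rewrite (_ : mkset _ = (fun omega => (r f omega).1) @^-1` [set true] `&`
  \bigcap_(v in [set: 'I_n])
    (fun omega => (nmem (r f omega).2 v != 0%N)) @^-1` [set v \in A]); last first.
  apply/seteqP; split => omega /=.
    move=> /andP[r1 /eqP rA]; split => // v _ /=.
    by rewrite -rA inE.
  move=> [-> rA]; apply/eqP/setP => v; rewrite inE.
  exact: rA.
apply: measurableI; first by rewrite -[X in measurable X]setTI; exact: m1.
apply: fin_bigcap_measurable => // v _; rewrite -[X in measurable X]setTI.
have mnz : measurable_fun setT (fun k : nat => k != 0%N) by [].
exact: (measurableT_comp mnz (mmN v)).
Qed.

End MeasurableOutput.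

(** * Independent exponential variables *)

Lemma bin_le_exp2 n k : ('C(n, k) <= 2 ^ n)%N.
Proof.
elim: n k => [|n IHn] [|k] //; first by rewrite bin0 expn_gt0.
by rewrite binS expnS mul2n -addnn leq_add.
Qed.

(** Filling the coordinates greedily until the total is [M]. It lets the union bound range over the
    finitely many points of sum exactly [M]. *)
Lemma truncated_sum k (u : nat -> nat) M : (M <= \sum_(i < k) u i)%N ->
  exists2 t : nat -> nat, (forall i, (t i <= u i)%N) & (\sum_(i < k) t i = M)%N.
Proof.
elim: k M => [|k IHk] M.
  by rewrite big_ord0 leqn0 => /eqP->; exists (fun=> 0%N) => //; rewrite big_ord0.
rewrite big_ord_recr /=; case: (leqP M (\sum_(i < k) u i)) => [/IHk[t tu tM] _|uM Mu].
  exists (fun i => if i == k then 0%N else t i) => [i|]; first by case: eqP.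
  rewrite big_ord_recr /= eqxx addn0 -tM; apply: eq_bigr => i _.
  by rewrite ifF//; have := ltn_ord i; lia.
exists (fun i => if i == k then (M - \sum_(i < k) u i)%N else u i) => [i|].
  by case: eqP => [->|//]; rewrite leq_subLR.
rewrite big_ord_recr /= eqxx (eq_bigr (fun i : 'I_k => u i)) => [|i _].
  exact/subnKC/ltnW.
by rewrite ifF//; have := ltn_ord i; lia.
Qed.

(** * Law of the draws on orthants, memorylessness, tail of the sum *)

Section ExpSource.
Context {R : realType} {d : measure_display} {Omega : measurableType d}.
Variables (Pr : probability Omega R) (xi : nat -> {RV Pr >-> R}).
Hypothesis xi_exp : exp_source xi.
Local Open Scope classical_set_scope.
Import numFieldNormedType.Exports.

Lemma measurable_xi_preimage i (A : set R) :
  measurable A -> measurable (xi i @^-1` A).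
Proof. by move=> mA; rewrite -[X in measurable X]setTI; exact: measurable_funP. Qed.

Lemma Pr_xi_lt i (x : R) : Pr (xi i @^-1` `]-oo, x[) = (1 - expR (- Num.max x 0))%:E.
Proof.
have Pr_xi A : measurable A -> Pr (xi i @^-1` A) = exponential_prob 1 A.
  by move=> mA; exact: xi_exp.1.
have pdf0 y : y <= 0 -> Pr (xi i @^-1` `]-oo, y[) = 0%E.
  move=> y0; rewrite Pr_xi// /exponential_prob integral0_eq// => z /=.
  rewrite in_itv /= => zy; congr EFin; apply: lt0_exponential_pdf.
  exact: lt_le_trans zy y0.
have [x0|x0] := leP x 0.
  by rewrite pdf0// oppr0 expR0 subrr.
have -> : xi i @^-1` `]-oo, x[ = xi i @^-1` `]-oo, 0%R[ `|` xi i @^-1` `[0, x[.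
  rewrite -preimage_setU; congr (_ @^-1` _).
  apply/seteqP; split => z /=; rewrite !in_itv /=.
    by move=> zx; case: (ltP z 0) => z0; [left|right].
  by case=> [z0|/andP[]//]; exact: lt_trans z0 x0.
rewrite measureU; last 3 first.
- exact: measurable_xi_preimage.
- exact: measurable_xi_preimage.
- rewrite -preimage_setI (_ : _ `&` _ = set0) ?preimage_set0//.
  apply/seteqP; split => z //=; rewrite !in_itv /= => -[z0 /andP[]].
  by rewrite leNgt z0.
rewrite [X in (X + _)%E](_ : _ = 0%E); last exact: pdf0.
rewrite add0e [LHS](_ : _ = exponential_prob 1 `[0, x[); last exact: Pr_xi.
rewrite /exponential_prob integral_itv_bndo_bndc; last first.
  apply/measurable_EFinP; apply: measurable_funTS.
  exact: measurable_exponential_pdf.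
have := exponential_prob_itv0c 1 x0; rewrite /exponential_prob => ->.
by rewrite mulN1r EFinB.
Qed.

Lemma Pr_xi_ge i (x : R) : Pr (xi i @^-1` `[x, +oo[) = (expR (- Num.max x 0))%:E.
Proof.
rewrite -setCitvl -preimage_setC probability_setC; last exact: measurable_xi_preimage.
by rewrite Pr_xi_lt EFinB oppeB// addeA subee// add0e.
Qed.

(** Orthants form a pi-system whose probabilities are explicit products and which translations
    preserve. The sigma-algebra they generate, depending on [k] coordinates only, is all the privacy
    argument needs. *)
Definition orthant (k : nat) (x : nat -> R) : set (nat -> R) :=
  [set w | forall i, (i < k)%N -> x i <= w i].

Definition orthants (k : nat) : set (set (nat -> R)) := range (orthant k).

Definition sources (omega : Omega) : nat -> R := fun i => xi i omega.

Lemma sources_orthant k (x : nat -> R) :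
  sources @^-1` orthant k x = \bigcap_(i in `I_k) (xi i @^-1` `[x i, +oo[).
Proof.
apply/seteqP; split => omega h i /= ik; first by rewrite in_itv /= andbT; exact: h.
by have := h i ik; rewrite /= in_itv /= andbT.
Qed.

Lemma measurable_sources_orthant k x : measurable (sources @^-1` orthant k x).
Proof.
rewrite sources_orthant; apply: fin_bigcap_measurable => // i _.
exact: measurable_xi_preimage.
Qed.

Lemma Pr_orthant k (x : nat -> R) :
  Pr (sources @^-1` orthant k x) = (expR (- \sum_(i < k) Num.max (x i) 0))%:E.
Proof.
rewrite sources_orthant (xi_exp.2 k (fun i => `[x i, +oo[))//.
rewrite -sumrN expR_sum -prodEFin; apply: eq_bigr => i _.
exact: Pr_xi_ge.
Qed.

Lemma setI_closed_orthants k : setI_closed (orthants k).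
Proof.
move=> _ _ [x _ <-] [y _ <-]; exists (fun i => Num.max (x i) (y i)) => //.
apply/seteqP; split => w /=; last first.
  by move=> [wx wy] i ik; rewrite ge_max wx ?wy.
by move=> h; split=> i /h; rewrite ge_max => /andP[].
Qed.

(** Supplies the exhausting sequence for the uniqueness theorem of measures; the sum of the first
    [k] absolute values bounds each of them. *)
Lemma orthants_cover k : \bigcup_m orthant k (fun=> - m%:R) = setT.
Proof.
apply/seteqP; split => // w _.
pose S : R := \sum_(i < k) `|w i|; have S0 : 0 <= S by exact: sumr_ge0.
exists (Num.bound S) => // i ik; have := archi_boundP S0.
rewrite lerNl => /ltW; apply: le_trans.
rewrite (le_trans (ler_norm _))// normrN /S (bigD1 (Ordinal ik))//= lerDl.
exact: sumr_ge0.
Qed.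

Lemma measurable_orthant k x :
  measurable (orthant k x : set (g_sigma_algebraType (orthants k))).
Proof. by apply: sub_sigma_algebra; exists x. Qed.

Lemma measurable_coord k i : (i < k)%N ->
  measurable_fun setT (fun w : g_sigma_algebraType (orthants k) => w i).
Proof.
move=> ik; apply: (measurability _ (RGenCInfty.measurableE R)).
move=> _ [_ [x ->] <-]; rewrite setTI.
(* A half-space is the increasing union of orthants whose other thresholds tend to minus
   infinity. *)
rewrite (_ : _ @^-1` _ =
  \bigcup_m orthant k (fun j => if j == i then x else - m%:R)); last first.
  apply/seteqP; split => w /=; rewrite in_itv /= andbT.
    move=> xw; have : [set: nat -> R] w by [].
    rewrite -(orthants_cover k) => -[m _ wm]; exists m => // j jk.
    by case: eqP => [->//|_]; exact: wm.
  by move=> [m _ /(_ i ik)]; rewrite eqxx.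
by apply: bigcup_measurable => m _; exact: measurable_orthant.
Qed.

Lemma measurable_seqs k (f : Omega -> nat -> R) :
  (forall i, measurable_fun setT (fun omega => f omega i)) ->
  measurable_fun setT (f : Omega -> g_sigma_algebraType (orthants k)).
Proof.
move=> mf.
apply: (@measurability _ _ _ (g_sigma_algebraType (orthants k)) _ _ (orthants k)) => //.
move=> _ [_ [x _ <-] <-]; rewrite setTI.
rewrite (_ : _ @^-1` _ = \bigcap_(i in `I_k) ((fun omega => f omega i) @^-1` `[x i, +oo[)).
  apply: fin_bigcap_measurable => // i _; rewrite -[X in measurable X]setTI.
  exact: mf.
apply/seteqP; split => omega h i /= ik; first by rewrite in_itv /= andbT; exact: h.
by have := h i ik; rewrite /= in_itv /= andbT.
Qed.

(* Memorylessness; equality of the two laws need only be checked on orthants. *)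
Lemma Pr_shift k (a : nat -> R) (E : set (g_sigma_algebraType (orthants k))) :
  (forall i, 0 <= a i) -> measurable E ->
  Pr (sources @^-1` E) =
  ((expR (\sum_(i < k) a i))%:E *
   Pr ((fun omega i => (sources omega i - a i)%R) @^-1` E `&`
       sources @^-1` orthant k a))%E.
Proof.
move=> a0 mE.
have mx : measurable_fun setT (sources : Omega -> g_sigma_algebraType (orthants k)).
  by apply: measurable_seqs => i; exact: measurable_funP.
pose shifted omega : g_sigma_algebraType (orthants k) :=
  fun i => (sources omega i - a i)%R.
have mshift : measurable_fun setT shifted.
  by apply: measurable_seqs => i; exact: measurable_funB.
have mD := measurable_sources_orthant k a.
pose m1 := measure_function_pushforward__canonical__measure_function_Measure Pr mx.
pose m2 : {measure set (g_sigma_algebraType (orthants k)) -> \bar R} :=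
  mscale (NngNum (expR_ge0 (\sum_(i < k) a i)))
  (measure_function_pushforward__canonical__measure_function_Measure
     (mrestr Pr mD) mshift).
rewrite -[LHS]/(m1 E) -[RHS]/(m2 E).
apply: (@measure_unique _ _ (g_sigma_algebraType (orthants k)) (orthants k)
  (fun m => orthant k (fun=> - m%:R)) _ _ _ _ m1 m2) => //.
- exact: setI_closed_orthants.
- by move=> m; exists (fun=> - m%:R).
- exact: orthants_cover.
- move=> _ [x _ <-] /=.
  rewrite -[LHS]/(Pr (sources @^-1` orthant k x)) Pr_orthant.
  rewrite /mscale /= /pushforward /mrestr /=.
  (* The constraints w_i >= a_i and w_i - a_i >= x_i merge into w_i >= a_i + max(x_i, 0); the a_i
     then cancel the prefactor. *)
  rewrite (_ : _ `&` _ = sources @^-1` orthant k (fun i => a i + Num.max (x i) 0)).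
    rewrite Pr_orthant -EFinM -expRD; congr (expR _)%:E.
    rewrite [X in _ - X](eq_bigr (fun i : 'I_k => a i + Num.max (x i) 0)).
      by rewrite big_split /= opprD addrA subrr add0r.
    by move=> i _; rewrite max_l// addr_ge0// le_max lexx orbT.
  apply/seteqP; split => omega /=.
    move=> [h1 h2] i ik; rewrite -lerBrDl ge_max subr_ge0 h2// andbT.
    exact: h1.
  move=> h; split => i /h; rewrite -lerBrDl ge_max => /andP[] //.
  by rewrite subr_ge0.
- move=> m; rewrite -[X in (X < _)%E]/(Pr (sources @^-1` orthant k (fun=> - m%:R))).
  by rewrite Pr_orthant ltry.
Qed.

Lemma Pr_bigsetU_le (I : Type) (r : seq I) (P : pred I) (F : I -> set Omega) :
  (forall i, measurable (F i)) ->
  (Pr (\big[setU/set0]_(i <- r | P i) F i) <= \sum_(i <- r | P i) Pr (F i))%E.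
Proof.
move=> mF; elim: r => [|i r IHr]; first by rewrite !big_nil measure0.
rewrite !big_cons; case: ifP => // Pi.
apply: (@le_trans _ _ (Pr (F i) + Pr (\big[setU/set0]_(i <- r | P i) F i))%E).
  by apply: measureU2 => //; exact: bigsetU_measurable.
exact: leeD2l.
Qed.

Lemma Pr_orthant0C k : Pr (~` (sources @^-1` orthant k (fun=> 0))) = 0%E.
Proof.
rewrite probability_setC ?Pr_orthant; last exact: measurable_sources_orthant.
by rewrite big1 ?oppr0 ?expR0 ?subee// => i _; rewrite maxxx.
Qed.

Lemma measurable_sum_sources k (z : R) :
  measurable [set omega | z <= \sum_(i < k) Num.max (sources omega i) 0].
Proof.
have mS : measurable_fun setT (fun omega => \sum_(i < k) Num.max (sources omega i) 0).
  by apply: measurable_sum => i; exact: measurable_maxr.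
have := mS measurableT `[z, +oo[%classic; rewrite setTI => /(_ _).
rewrite (_ : _ @^-1` _ = [set omega | z <= \sum_(i < k) Num.max (sources omega i) 0]).
  by apply; exact: measurable_itv.
by apply/seteqP; split => omega /=; rewrite in_itv /= andbT.
Qed.

(* If the sum exceeds 2 (M + k) then some k-tuple of naturals t with sum M
   satisfies [2 * t_i <= xi_i] for all i, and there are at most 2 ^ (M + k) such
   tuples, each of which has probability at most [expR (- 2 * M)]. *)
Lemma Pr_sum_tail k M :
  (Pr [set omega | ((2 * (M + k.+1))%:R <=
                    \sum_(i < k.+1) Num.max (sources omega i) 0)%R] <=
   (2 ^+ k.+1 * expR (- M%:R))%:E)%E.
Proof.
pose thresh (t : k.+1.-tuple 'I_M.+1) (i : nat) : R := (2 * nth ord0 t i)%:R.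
pose Ts := [set t : k.+1.-tuple 'I_M.+1 | (\sum_(i <- t) i == M)%N]%SET.
pose U := \big[setU/set0]_(t in Ts) (sources @^-1` orthant k.+1 (thresh t)).
have mU : measurable U.
  by apply: bigsetU_measurable => t _; exact: measurable_sources_orthant.
pose N := ~` (sources @^-1` orthant k.+1 (fun=> 0)).
have mN : measurable N by apply: measurableC; exact: measurable_sources_orthant.
apply: (@le_trans _ _ (Pr (N `|` U))).
  apply: le_measure; rewrite ?inE; first exact: measurable_sum_sources.
    exact: measurableU.
  move=> omega /= large.
  have [pos|] := pselect ((sources @^-1` orthant k.+1 (fun=> 0)) omega);
    [right|by left].
  pose u i := Num.truncn (sources omega i / 2).
  have uP i : (i < k.+1)%N -> (u i)%:R <= sources omega i / 2 < (u i).+1%:R.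
    by move=> ik; apply: truncn_itv; rewrite divr_ge0//; exact: pos.
  (* Rounding down loses less than 1 in each of the k + 1 coordinates, whence the k + 1 in the
     threshold. *)
  have Mu : (M <= \sum_(i < k.+1) u i)%N.
    rewrite -(leq_add2r k.+1) -(@leq_pmul2l 2)// -(@ler_nat R) (le_trans large)//.
    have -> : (\sum_(i < k.+1) u i + k.+1 = \sum_(i < k.+1) (u i).+1)%N.
      under [RHS]eq_bigr do rewrite -addn1.
      by rewrite big_split /= sum1_card card_ord.
    rewrite natrM natr_sum mulr_sumr; apply: ler_sum => i _.
    have /andP[_ /ltW ui] := uP i (ltn_ord i).
    rewrite max_l; last exact: pos.
    by rewrite mulrC -ler_pdivrMr.
  have [t tu tM] := truncated_sum Mu.
  have tleM (i : 'I_k.+1) : (t i < M.+1)%N.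
    by rewrite ltnS -tM (bigD1 i)//= leq_addr.
  pose tt : k.+1.-tuple 'I_M.+1 := [tuple inord (t i) | i < k.+1].
  have ttTs : tt \in Ts.
    rewrite inE big_tuple; apply/eqP; apply: etrans tM; apply: eq_bigr => i _.
    by rewrite tnth_mktuple inordK.
  rewrite /U (bigD1 tt)//=; left => i ik.
  rewrite /thresh -[i]/(nat_of_ord (Ordinal ik)) nth_mktuple inordK//.
  have /andP[ui _] := uP i ik.
  by rewrite natrM mulrC -ler_pdivlMr// (le_trans _ ui)// ler_nat.
apply: (@le_trans _ _ (Pr N + Pr U)%E); first exact: measureU2.
rewrite [Pr N]Pr_orthant0C add0e (le_trans (Pr_bigsetU_le _ _ _))//.
  by move=> t; exact: measurable_sources_orthant.
rewrite (eq_bigr (fun=> (expR (- (2 * M)%:R))%:E)); last first.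
  move=> t; rewrite inE => /eqP tM; rewrite Pr_orthant; congr (expR (- _))%:E.
  apply: etrans (congr1 (fun m => (2 * m)%:R) tM).
  rewrite big_tuple big_distrr natr_sum /=; apply: eq_bigr => i _.
  by rewrite max_l ?ler0n// /thresh (tnth_nth ord0).
rewrite sumEFin lee_fin sumr_const card_ord_partitions -[_ *+ 'C(_, _)]mulr_natl.
(* The doubled thresholds give exp(-2M); one factor exp(-M) pays for the 2^M in the number of
   tuples. *)
have e2 : (2 : R) ^+ M <= expR M%:R.
  rewrite -[M%:R]mulr1 expRM_natl.
  by rewrite lerXn2r ?nnegrE ?expR_ge0// -[2]/(1 + 1 : R) expR_ge1Dx.
apply: (@le_trans _ _ (2 ^+ (k.+1 + M) * expR (- (2 * M)%:R))).
  rewrite ler_wpM2r ?expR_ge0// -natrX ler_nat (leq_trans (bin_le_exp2 _ _))//.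
  by rewrite leq_pexp2l// addSn.
rewrite exprD -mulrA ler_wpM2l ?exprn_ge0//.
rewrite mul2n -addnn natrD opprD expRD mulrA -[leRHS]mul1r ler_wpM2r ?expR_ge0//.
by rewrite expRN -ler_pdivlMr ?invr_gt0 ?expR_gt0// invrK mul1r.
Qed.

(** With 2n draws and M = (2 + c) n the tail is at most 2^(2n) exp(-(2 + c) n) <= exp(-c n), and n
    <= exp(n) turns this into n^-c. *)
Lemma Pr_noise_large (n c : nat) : (0 < n)%N ->
  (Pr [set omega | ((2 * ((2 + c) * n + (n + n)))%:R <=
                    \sum_(i < n + n) Num.max (sources omega i) 0)%R] <=
   (n%:R ^- c)%:E)%E.
Proof.
move=> n0; have -> : (n + n = (n + n).-1.+1)%N by rewrite prednK// addn_gt0 n0.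
apply: (le_trans (Pr_sum_tail _ _)); rewrite prednK ?addn_gt0 ?n0// lee_fin.
have e2 : (2 : R) <= expR 1 by rewrite -[2]/(1 + 1 : R) expR_ge1Dx.
apply: (@le_trans _ _ (expR 1 ^+ (n + n) * expR (- ((2 + c) * n)%:R))).
  by rewrite ler_wpM2r ?expR_ge0// lerXn2r ?nnegrE ?expR_ge0.
rewrite -expRM_natl -expRD mulr1 (_ : (2 + c) * n = n + n + c * n)%N; last by lia.
rewrite (natrD _ (n + n)%N (c * n)%N) opprD addrA subrr add0r.
rewrite expRN lef_pV2 ?posrE ?exprn_gt0 ?ltr0n ?expR_gt0//.
rewrite natrM expRM_natl lerXn2r ?nnegrE ?ler0n ?expR_ge0//.
by rewrite (le_trans _ (expR_ge1Dx _))// lerDr.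
Qed.

End ExpSource.

(** * The private algorithm *)

Section Noisy.
Context {R : realType} {n : nat}.
Variables (s t : 'I_n) (sc : R).
Hypothesis sc_ge0 : 0 <= sc.
Implicit Types (G : wgraph R n) (A B : {set 'I_n}) (w x : nat -> R).

Definition drop_tape (k : nat) w : nat -> R := fun i => w (k + i)%N.

(** Tape entry v is the noise between v and [s], paid when v lies outside the cut set; entry n + v
    is the noise towards [t], paid when v lies inside. *)
Definition noisy G w : wgraph R n :=
  star (star G (tape_noise_ge0 s t sc_ge0 w) (tape_noise_s s t sc w))
    (tape_noise_ge0 s t sc_ge0 (drop_tape n w))
    (tape_noise_t s t sc (drop_tape n w)).

Definition cut_noise w A : R :=
  \sum_(v in (~: A)%SET) tape_noise s t sc w v +
  \sum_(v in A) tape_noise s t sc (drop_tape n w) v.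

Lemma cut_value_noisy G w A : is_st_cut s t A ->
  cut_value (noisy G w) A = cut_value G A + cut_noise w A.
Proof.
move=> /andP[sA]; rewrite inE => tA.
by rewrite cut_value_star_out// cut_value_star_in// addrA.
Qed.

Lemma cut_noiseE w A : cut_noise w A =
  \sum_v (if v \in A then tape_noise s t sc (drop_tape n w) v
          else tape_noise s t sc w v).
Proof.
rewrite /cut_noise [X in X + _]big_mkcond [X in _ + X]big_mkcond -big_split /=.
by apply: eq_bigr => v _; rewrite inE; case: (v \in A); rewrite /= ?addr0 ?add0r.
Qed.

Lemma cut_noise_ge0 w A : 0 <= cut_noise w A.
Proof. by rewrite addr_ge0// sumr_ge0// => v _; exact: tape_noise_ge0. Qed.

Lemma positive_noiseE (y : R) : positive_noise sc y = Num.max y 0 * sc.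
Proof. by rewrite /positive_noise; case: ltP; rewrite ?mul0r. Qed.

Lemma tape_noise_le w (v : nat) : tape_noise s t sc w v <= Num.max (w v) 0 * sc.
Proof.
rewrite /tape_noise; case: ifP => _; last by rewrite positive_noiseE.
by rewrite mulr_ge0// le_max lexx orbT.
Qed.

Lemma cut_noise_le w A :
  cut_noise w A <= (\sum_(i < n + n) Num.max (w i) 0) * sc.
Proof.
rewrite big_split_ord /= mulrDl !mulr_suml.
have max_ge0 (y : R) : 0 <= Num.max y 0 * sc by rewrite mulr_ge0// le_max lexx orbT.
apply: lerD; rewrite big_mkcond; apply: ler_sum => v _; case: ifP => _ //.
  exact: tape_noise_le.
exact: tape_noise_le.
Qed.

(** * Changing one edge weight versus shifting the noise *)

Lemma cut_valueB_neighbor G G' (u v : 'I_n) A :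
  (forall u' v' : 'I_n, (u', v') <> (u, v) -> (u', v') <> (v, u) ->
     G u' v' = G' u' v') ->
  cut_value G' A - cut_value G A =
  if (u \in A) != (v \in A) then G' u v - G u v else 0.
Proof.
move=> GG'.
(* If [A] separates the pair, orient it so that [u] is inside; the double sum then contains it once,
   as (u, v). *)
wlog uvA : u v GG' / (v \in A) ==> (u \in A).
  move=> W; have [|uA] := boolP ((v \in A) ==> (u \in A)); first exact: W.
  rewrite eq_sym [G' u v]wt_sym [G u v]wt_sym; apply: W => [u' v' h1 h2|].
    exact: GG'.
  by move: uA; case: (u \in A); case: (v \in A).
rewrite !cut_valueE -sumrB.
under eq_bigr do rewrite -sumrB.
rewrite pair_big_dep /=; case: ifPn => uv.
  have [uA vA] : u \in A /\ v \notin A.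
    by move: uv uvA; case: (u \in A); case: (v \in A).
  rewrite (bigD1 (u, v)) /=; last by rewrite uA inE.
  rewrite big1 ?addr0// => -[u' v'] /= /andP[/andP[u'A v'A] /eqP uv'].
  rewrite GG' ?subrr// => -[_ v'u].
  by move: v'A; rewrite inE v'u uA.
rewrite big1// => -[u' v'] /= /andP[u'A]; rewrite inE => v'A.
rewrite GG' ?subrr// => -[u'E v'E]; move: uv u'A v'A; rewrite u'E v'E;
  by case: (u \in A); case: (v \in A).
Qed.

(* Raises the price of moving a node [v] across the cut [A] by [h v]. *)
Definition shift A (h : 'I_n -> R) (i : nat) : R :=
  if insub i is Some v then if v \in A then h v else 0
  else if insub (i - n)%N is Some v then if v \in A then 0 else h v
  else 0.

Lemma shift_lo A h (v : 'I_n) : shift A h v = if v \in A then h v else 0.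
Proof. by rewrite /shift valK. Qed.

Lemma shift_hi A h (v : 'I_n) : shift A h (n + v)%N = if v \in A then 0 else h v.
Proof. by rewrite /shift insubF ?addKn ?valK// ltnNge leq_addr. Qed.

Lemma shift_ge0 A h i : (forall v, 0 <= h v) -> 0 <= shift A h i.
Proof.
move=> h0; rewrite /shift; case: (insub i) => [v|]; first by case: ifP.
by case: (insub _) => [v|//]; case: ifP.
Qed.

(** Exactly one of the two noise variables of each node is raised, so the price of the shift does
    not depend on [A]. *)
Lemma sum_shift A h : \sum_(i < n + n) shift A h i = \sum_v h v.
Proof.
rewrite big_split_ord /= -big_split /=; apply: eq_bigr => v _.
by rewrite shift_lo shift_hi; case: ifP; rewrite ?addr0 ?add0r.
Qed.

(** The bounds make the clamp at 0 inactive before and after the shift, so the noise responds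
    linearly. *)
Lemma tape_noise_shift w (a : nat -> R) (v : 'I_n) : 0 <= a v <= w v ->
  v != s -> v != t ->
  tape_noise s t sc w v = tape_noise s t sc (fun i => w i - a i) v + a v * sc.
Proof.
move=> /andP[a0 aw] vs vt; rewrite /tape_noise !(inj_eq val_inj).
rewrite (negbTE vs) (negbTE vt) leqNgt ltn_ord /= !positive_noiseE.
by rewrite !max_l ?subr_ge0//; [rewrite mulrBl subrK|exact: le_trans aw].
Qed.

(** A node on the same side in both cuts contributes equally to both. A node that moves is not a
    terminal, and it is [B] that pays its raised noise. *)
Lemma cut_noise_shift w A B (h : 'I_n -> R) :
  is_st_cut s t A -> is_st_cut s t B -> (forall v, 0 <= h v) ->
  (forall i, (i < n + n)%N -> shift A h i <= w i) ->
  let w' i := w i - shift A h i in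
  cut_noise w B - cut_noise w A =
  cut_noise w' B - cut_noise w' A +
  \sum_v (if (v \in A) != (v \in B) then h v * sc else 0).
Proof.
move=> /andP[sA tA] /andP[sB tB] h0 hw w'.
rewrite !cut_noiseE -!sumrB -big_split /=; apply: eq_bigr => v _.
have [AB|AB] := eqVneq (v \in A) (v \in B).
  by rewrite AB addr0; case: ifP; rewrite !subrr.
have vs : v != s.
  by apply: contraNneq AB => ->; rewrite sA sB.
have vt : v != t.
  by apply: contraNneq AB => ->; move: tA tB; rewrite !inE => /negbTE-> /negbTE->.
have lo : tape_noise s t sc w v = tape_noise s t sc w' v + shift A h v * sc.
  apply: tape_noise_shift => //; rewrite shift_ge0//= hw//.
  by rewrite (leq_trans (ltn_ord v))// leq_addr.
have hi : tape_noise s t sc (drop_tape n w) v =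
    tape_noise s t sc (drop_tape n w') v + shift A h (n + v)%N * sc.
  apply: (tape_noise_shift (a := fun i => shift A h (n + i)%N)) => //.
  by rewrite shift_ge0//= hw// ltn_add2l.
rewrite lo hi shift_lo shift_hi; move: AB.
by case: (v \in A); case: (v \in B) => //= _; rewrite ?mul0r; ring.
Qed.

(** Any other cut [B] moves some node and pays at least delta, and at least 1 + delta if it moves
    [u] or [v]. Passing from [G] to [G'] alters the comparison of [A] with [B] by at most 1, and not
    at all if [u] and [v] keep their sides. So [A] wins strictly. *)
Lemma shifted_min_unique G G' w A (u v : 'I_n) (delta : R) : s != t ->
  `|G u v - G' u v| <= 1 ->
  (forall u' v' : 'I_n, (u', v') <> (u, v) -> (u', v') <> (v, u) ->
     G u' v' = G' u' v') ->
  0 < delta -> 0 < sc ->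
  let h (x : 'I_n) := (delta + ((x == u) || (x == v))%:R) / sc in
  (forall i, (i < n + n)%N -> shift A h i <= w i) ->
  is_min_st_cut (noisy G (fun i => w i - shift A h i)) s t A ->
  forall B, is_min_st_cut (noisy G' w) s t B -> B = A.
Proof.
move=> st uv1 GG' d0 sc0 h hw.
move=> /(is_min_st_cutP _ _ st)[Acut Amin] B /(is_min_st_cutP _ _ st)[Bcut Bmin].
apply/eqP/negPn/negP => BA.
have h0 (x : 'I_n) : 0 <= h x by rewrite divr_ge0 ?addr_ge0 ?ler0n// ltW.
pose pen := \sum_(x : 'I_n) (if (x \in A) != (x \in B) then h x * sc else 0).
have penE (x : 'I_n) : h x * sc = delta + ((x == u) || (x == v))%:R.
  by rewrite divfK// gt_eqF.
have pen_ge (x : 'I_n) : (x \in A) != (x \in B) ->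
    delta + ((x == u) || (x == v))%:R <= pen.
  move=> AB; rewrite /pen (bigD1 x)//= AB penE lerDl sumr_ge0// => y _.
  by case: ifP => // _; rewrite mulr_ge0.
have [x xAB] : exists x : 'I_n, (x \in A) != (x \in B).
  apply/existsP; rewrite -negb_forall; apply: contra BA => /forallP AB.
  by apply/eqP/setP => x; apply/esym/eqP.
have pen_delta : delta <= pen.
  by rewrite (le_trans _ (pen_ge _ xAB))// lerDl ler0n.
have := Amin _ Bcut; have := Bmin _ Acut; rewrite !cut_value_noisy//.
have := cut_noise_shift Acut Bcut h0 hw; rewrite -/pen /=.
have := cut_valueB_neighbor A GG'; have := cut_valueB_neighbor B GG'.
have [uAB|uAB] := eqVneq (u \in A) (u \in B);
  have [vAB|vAB] := eqVneq (v \in A) (v \in B).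
- by rewrite uAB vAB; case: ifP => _; lra.
- have := pen_ge v vAB; rewrite eqxx orbT /=.
  by move: uv1; rewrite ler_norml => /andP[]; do 2 case: ifP => _; lra.
- have := pen_ge u uAB; rewrite eqxx /=.
  by move: uv1; rewrite ler_norml => /andP[]; do 2 case: ifP => _; lra.
- have := pen_ge u uAB; rewrite eqxx /=.
  by move: uv1; rewrite ler_norml => /andP[]; do 2 case: ifP => _; lra.
Qed.

End Noisy.

Definition private_cut (R : realType) (sc : R) (p : prog R) : prog R :=
  Seq (add_star sc 2) (Seq (add_star sc 3) p).

(** * Specification and running time of the composed program *)

Section PrivateCut.
Context {R : realType}.
Variables (sc : R) (p : prog R).
Hypotheses (sc_gt0 : 0 < sc) (p_solves : solves_min_st_cut p).
Let sc_ge0 : 0 <= sc := ltW sc_gt0.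
Local Notation q := (private_cut sc p).

Lemma private_cut_exec n (G : wgraph R n) s t l w : input_of G s t l ->
  exists l' k, [/\ input_of (noisy s t sc_ge0 G w) s t l',
    (size l <= size l' <= size l + 2 * n)%N, (k <= 67 * (n + size l'))%N
    & forall k' st,
      exec p (init (noisy s t sc_ge0 G w) s t l' (drop_tape n (drop_tape n w))) k' st ->
      exec q (init G s t l w) (k + k') st].
Proof.
move=> [st lG].
have [l1 [l1G /andP[ll1 l1l] [k1 [st1 [e1 k1c st1E]]]]] :=
  add_starP sc_ge0 (tape_noise_s s t sc w) (or_introl (conj erefl erefl)) lG.
rewrite -st1E in e1.
have [l2 [l2G /andP[ll2 l2l] [k2 [st2 [e2 k2c st2E]]]]] :=
  add_starP sc_ge0 (tape_noise_t s t sc (drop_tape n w))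
    (or_intror (conj erefl erefl)) l1G.
rewrite -st2E in e2.
(* Distinct terminals force n >= 2, so the additive 2 * 23 of the two passes is at most 23 n; hence
   67 = 2 * 22 + 23. *)
have n2 : (1 < n)%N.
  by have := ltn_ord s; have := ltn_ord t; move: st; rewrite -val_eqE /=; lia.
exists l2, (k1 + k2)%N; split => //.
- by lia.
- by lia.
- by move=> k' st' e; rewrite -addnA; apply: exec_seq e1 (exec_seq e2 e).
Qed.

Lemma private_cut_returns n (G : wgraph R n) s t l w : input_of G s t l ->
  exists2 A, returns q G s t l w A & is_min_st_cut (noisy s t sc_ge0 G w) s t A.
Proof.
move=> inG; have [l' [k [inG' _ _ ex]]] := private_cut_exec w inG.
have [A [[k' [st' [e stA]]] Amin]] := p_solves inG' (drop_tape n (drop_tape n w)).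
by exists A => //; exists (k + k')%N, st'; split => //; exact: ex.
Qed.

Lemma private_cut_min n (G : wgraph R n) s t l w A : input_of G s t l ->
  returns q G s t l w A -> is_min_st_cut (noisy s t sc_ge0 G w) s t A.
Proof.
move=> inG rA; have [B rB Bmin] := private_cut_returns w inG.
by rewrite (returns_det rA rB).
Qed.

Lemma private_cut_st_cut_algorithm : st_cut_algorithm q.
Proof.
move=> n G s t l inG; split => [w|*]; last exact: measurable_output_event.
by have [A rA [Acut _]] := private_cut_returns w inG; exists A.
Qed.

Lemma private_cut_time : as_fast_as 68 q p.
Proof.
move=> T pT n G s t l inG m lm w.
have [l' [k [inG' /andP[ll' l'l] kl ex]]] := private_cut_exec w inG.
have l'm : (size l' <= m + 2 * n)%N by lia.
have [k' [st' [e k'T]]] := pT _ _ _ _ _ inG' _ l'm (drop_tape n (drop_tape n w)).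
exists (k + k')%N, st'; split; first exact: ex.
(* 68 = 67 + 1: the noise passes cost at most 67 (n + size l'), reading the original list at most n
   + size l', and the bound for [p] already charges n + size l'. *)
rewrite (leq_trans _ (leq_mul (leqnn 68) k'T))//; lia.
Qed.

(** * Accuracy and privacy *)

Section Probability.
Context {d : measure_display} {Omega : measurableType d}.
Variables (Pr : probability Omega R) (xi : nat -> {RV Pr >-> R}).
Hypothesis xi_exp : exp_source xi.
Local Open Scope classical_set_scope.
Import numFieldNormedType.Exports.

Lemma private_cut_accurate n (G : wgraph R n) s t l c : input_of G s t l ->
  ((1 - n%:R ^- c)%:E <=
   Pr (output_event xi q G s t l
     [set A | is_st_cut s t A &
        (cut_value G A <= min_cut_value G s t +
           (2 * ((2 + c) * n + (n + n)))%:R * sc)%R]%SET))%E.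
Proof.
move=> inG; have st := inG.1.
pose big := [set omega | (2 * ((2 + c) * n + (n + n)))%:R <=
  \sum_(i < n + n) Num.max (sources xi omega i) 0].
have mbig : measurable big by exact: measurable_sum_sources.
have n0 : (0 < n)%N := leq_ltn_trans (leq0n s) (ltn_ord s).
apply: (@le_trans _ _ (Pr (~` big))).
  rewrite probability_setC// EFinB leeB//; exact: Pr_noise_large.
apply: le_measure; rewrite ?inE; [exact: measurableC|exact: measurable_output_event|].
move=> omega /= /negP; rewrite -ltNge => small.
have [A rA Amin] := private_cut_returns (sources xi omega) inG.
exists A => //; rewrite inE.
have [Acut Amin'] := (is_min_st_cutP _ _ st).1 Amin; rewrite Acut /=.
have [[B Bcut <-] _] := min_cut_valueP G st.
(* [B] is optimal without noise, so value A <= value A + noise A <= value B + noise B, and noise B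
   is at most the total noise. *)
have := Amin' _ Bcut; rewrite !cut_value_noisy// => AB.
have := cut_noise_ge0 s t sc_ge0 (sources xi omega) A.
have := cut_noise_le s t sc_ge0 (sources xi omega) B.
have : (\sum_(i < n + n) Num.max (sources xi omega i) 0) * sc <=
  (2 * ((2 + c) * n + (n + n)))%:R * sc by rewrite ler_wpM2r// ltW.
by lra.
Qed.

(** Membership in the sigma-algebra of the first 2n coordinates is what [Pr_shift] asks for; the
    event is a finite intersection of inequalities between noisy cut values. *)
Lemma measurable_noisy_min n (G : wgraph R n) s t A : s != t ->
  measurable ([set w | is_min_st_cut (noisy s t sc_ge0 G w) s t A] :
    set (g_sigma_algebraType (@orthants R (n + n)))).
Proof.
move=> st.
have [Acut|Acut] := boolP (is_st_cut s t A); last first.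
  rewrite (_ : mkset _ = set0); first exact: measurable0.
  by apply/seteqP; split => // w -[]; rewrite (negbTE Acut).
pose f (B : {set 'I_n}) (w : g_sigma_algebraType (@orthants R (n + n))) : R :=
  cut_value G B + cut_noise s t sc w B.
have mtape (g : nat -> nat) (v : 'I_n) : (forall i, (i < n)%N -> (g i < n + n)%N) ->
    measurable_fun setT (fun w : g_sigma_algebraType (@orthants R (n + n)) =>
      tape_noise s t sc (fun i => w (g i)) v).
  move=> gn; rewrite /tape_noise.
  case: [|| nat_of_ord v == s, nat_of_ord v == t | (n <= v)%N] => //.
  rewrite (_ : (fun _ => _) = fun w : g_sigma_algebraType (@orthants R (n + n)) =>
      Num.max (w (g v)) 0 * sc); last by apply/funext => w; rewrite positive_noiseE.
  apply: measurable_funM => //; apply: measurable_maxr => //.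
  by apply: measurable_coord; exact: gn.
have mf B : measurable_fun setT (f B).
  apply: measurable_funD => //.
  rewrite (_ : (fun _ => _) = fun w : g_sigma_algebraType (@orthants R (n + n)) =>
    \sum_v (if v \in B then tape_noise s t sc (drop_tape n w) v
            else tape_noise s t sc w v)); last by apply/funext => w; exact: cut_noiseE.
  apply: measurable_sum => v; case: (v \in B).
    by apply: (mtape (addn n)) => i; lia.
  by apply: (mtape id) => i; lia.
rewrite (_ : mkset _ = \bigcap_(B in [set B | is_st_cut s t B])
    [set w | f A w <= f B w]); last first.
  apply/seteqP; split => w /=.
    move=> /(is_min_st_cutP _ _ st)[_ Amin] B Bcut; rewrite /f /=.
    by have := Amin B Bcut; rewrite !cut_value_noisy.
  move=> h; apply/is_min_st_cutP => //; split => // B Bcut.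
  by rewrite !cut_value_noisy//; exact: h.
apply: fin_bigcap_measurable => // B _.
rewrite -[X in measurable X]setTI.
by have := measurable_fun_ler (mf A) (mf B) measurableT (Y := [set true]); exact.
Qed.

Lemma le_expR_lim (x y : R) : 0 <= y -> (forall e, 0 < e -> x <= expR e * y) -> x <= y.
Proof.
move=> y0 h; rewrite leNgt; apply/negP => yx.
have x0 : 0 < x by exact: le_lt_trans yx.
(* Chosen so that (1 - e) x is the midpoint of x and y, which contradicts (1 - e) x <= exp(-e) x <=
   y. *)
pose e := (x - y) / (2 * x).
have e0 : 0 < e by rewrite divr_gt0 ?subr_gt0 ?mulr_gt0.
have : (1 - e) * x <= y.
  apply: (@le_trans _ _ (expR (- e) * x)).
    by rewrite ler_pM2r// expR_ge1Dx.
  by rewrite expRN -ler_pdivlMl ?invr_gt0 ?expR_gt0// invrK; exact: h.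
have -> : (1 - e) * x = (x + y) / 2 by rewrite /e; field; rewrite gt_eqF.
by lra.
Qed.

Lemma private_cut_private1 n (G G' : wgraph R n) s t l l' A :
  input_of G s t l -> input_of G' s t l' -> neighboring G G' ->
  (Pr (output_event xi q G s t l [set A]%SET) <=
   (expR (2 / sc))%:E * Pr (output_event xi q G' s t l' [set A]%SET))%E.
Proof.
move=> inG inG' [u [v [uv1 GG']]]; have st := inG.1.
have mO (H : wgraph R n) l0 O := measurable_output_event xi q H s t l0 O.
suff le_delta e : 0 < e ->
    (Pr (output_event xi q G s t l [set A]%SET) <=
     (expR (2 / sc + e))%:E * Pr (output_event xi q G' s t l' [set A]%SET))%E.
  have fin1 := fin_num_measure Pr _ (mO G l [set A]%SET).
  have fin2 := fin_num_measure Pr _ (mO G' l' [set A]%SET).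
  rewrite -(fineK fin1) -(fineK fin2) -EFinM lee_fin.
  apply: le_expR_lim => [|e e0]; first by rewrite mulr_ge0 ?expR_ge0// fine_ge0.
  rewrite mulrA -expRD addrC -lee_fin EFinM !fineK//; exact: le_delta.
move=> e0.
have n0 : (0 < n)%N := leq_ltn_trans (leq0n s) (ltn_ord s).
(* The slack is spent at all n nodes, so together it costs exactly [e] in the exponent. *)
pose delta := e * sc / n%:R.
have d0 : 0 < delta by rewrite divr_gt0 ?mulr_gt0 ?ltr0n.
pose h (x : 'I_n) : R := (delta + ((x == u) || (x == v))%:R) / sc.
have h0 x : 0 <= h x by rewrite divr_ge0 ?addr_ge0 ?ler0n// ltW.
pose E : set (g_sigma_algebraType (@orthants R (n + n))) :=
  [set w | is_min_st_cut (noisy s t sc_ge0 G w) s t A].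
have mE : measurable E by exact: measurable_noisy_min.
have mx : measurable (sources xi @^-1` E).
  rewrite -[X in measurable X]setTI.
  by apply: (@measurable_seqs _ _ _ (n + n) (sources xi)) => //.
have mshift : measurable
    ((fun omega i => (sources xi omega i - shift A h i)%R) @^-1` E).
  rewrite -[X in measurable X]setTI.
  apply: (@measurable_seqs _ _ _ (n + n)
    (fun omega i => (sources xi omega i - shift A h i)%R)) => // i.
  exact: measurable_funB.
apply: (@le_trans _ _ (Pr (sources xi @^-1` E))).
  apply: le_measure; rewrite ?inE// => omega [B]; rewrite inE => /eqP-> rA.
  exact: private_cut_min rA.
rewrite (Pr_shift xi_exp (a := shift A h) _ mE); last first.
  by move=> i; exact: shift_ge0.
apply: lee_pmul => //.
  rewrite lee_fin ler_expR sum_shift /h -mulr_suml big_split /= sumr_const card_ord.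
  have -> : delta *+ n = e * sc by rewrite -[_ *+ n]mulr_natr divfK// pnatr_eq0 -lt0n.
  rewrite mulrDl mulfK ?gt_eqF// addrC lerD2r ler_pM2r ?invr_gt0//.
  (* Only an inequality, since u = v is allowed. *)
  apply: (@le_trans _ _ (\sum_(x : 'I_n) ((x == u)%:R + (x == v)%:R))).
    apply: ler_sum => x _.
    by case: (x == u); case: (x == v); rewrite /= ?addr0 ?add0r ?lexx ?ler01// lerDl ler01.
  have sum1 (y : 'I_n) : \sum_(x : 'I_n) ((x == y)%:R : R) = 1.
    by rewrite (bigD1 y)//= eqxx big1 ?addr0// => x /negbTE->.
  by rewrite big_split /= !sum1.
apply: le_measure; rewrite ?inE//.
  by apply: measurableI => //; exact: measurable_sources_orthant.
move=> omega [/= Amin hw].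
have [B rB Bmin] := private_cut_returns (sources xi omega) inG'.
by exists B => //; rewrite inE (shifted_min_unique st uv1 GG' d0 sc_gt0 hw Amin Bmin).
Qed.

Lemma output_event_bigsetU n (G : wgraph R n) s t l (O : {set {set 'I_n}}) :
  output_event xi q G s t l O =
  \big[setU/set0]_(A <- enum O) output_event xi q G s t l [set A]%SET.
Proof.
rewrite -bigcup_seq; apply/seteqP; split => omega.
  by move=> [A AO rA]; exists A; rewrite /= ?mem_enum//; exists A; rewrite ?inE.
move=> [A /=]; rewrite mem_enum => AO [B]; rewrite inE => /eqP-> rA.
by exists A.
Qed.

Lemma Pr_bigsetU (I : choiceType) (r : seq I) (F : I -> set Omega) :
  uniq r -> (forall i, measurable (F i)) ->
  (forall i j omega, F i omega -> F j omega -> i = j) ->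
  Pr (\big[setU/set0]_(i <- r) F i) = (\sum_(i <- r) Pr (F i))%E.
Proof.
move=> ur mF dF; elim: r ur => [|i r IHr] /=; first by rewrite !big_nil measure0.
move=> /andP[ir ur]; rewrite !big_cons -IHr// measureU//.
  exact: bigsetU_measurable.
rewrite -bigcup_seq; apply/seteqP; split => // omega [Fi [j /= jr Fj]].
by move: ir; rewrite (dF _ _ _ Fi Fj) jr.
Qed.

(** A union bound on the left and exact additivity on the right, where determinism makes the events
    of distinct outputs disjoint. *)
Lemma private_cut_private n (G G' : wgraph R n) s t l l' O :
  input_of G s t l -> input_of G' s t l' -> neighboring G G' ->
  (Pr (output_event xi q G s t l O) <=
   (expR (2 / sc))%:E * Pr (output_event xi q G' s t l' O))%E.
Proof.
move=> inG inG' nGG'; rewrite !output_event_bigsetU.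
apply: le_trans; first apply: Pr_bigsetU_le => A.
  exact: measurable_output_event.
rewrite [in leRHS]Pr_bigsetU ?enum_uniq//; last 2 first.
- by move=> A; exact: measurable_output_event.
- move=> A B omega [A' + rA] [B' + rB]; rewrite !inE => /eqP<- /eqP<-.
  exact: returns_det rA rB.
rewrite ge0_sume_distrr//; apply: lee_sum => A _.
exact: private_cut_private1.
Qed.

End Probability.
End PrivateCut.

Lemma private_cut_correct (R : realType) (eps : R) (p : prog R) :
  0 < eps -> solves_min_st_cut p ->
  private_min_cut_algorithm eps (fun c => (4 * (4 + c))%:R) (private_cut (2 / eps) p).
Proof.
move=> eps0 ps; have sc0 : 0 < 2 / eps by rewrite divr_gt0.
split.
- exact: private_cut_st_cut_algorithm.
- move=> d Omega Pr xi xi_exp n G G' s t l l' inG inG' nGG' O.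
  have epsE : 2 / (2 / eps) = eps by rewrite invf_div mulrC divfK.
  rewrite adde0 -[X in expR X]epsE.
  exact: private_cut_private.
- move=> c d Omega Pr xi xi_exp n G s t l inG.
  (* The tail bound allows 2 (4 + c) n for the sum of standard draws, and each draw is scaled by
     2/eps. *)
  have -> : (4 * (4 + c))%:R * (n%:R / eps) =
      (2 * ((2 + c) * n + (n + n)))%:R * (2 / eps) :> R.
    by rewrite !(natrM, natrD); ring.
  exact: private_cut_accurate.
Qed.

Theorem theorem1 (R : realType) :
  exists (C : nat) (K : nat -> R), forall eps : R, 0 < eps ->
    (exists q : prog R, private_min_cut_algorithm eps K q) /\
    (forall p : prog R, solves_min_st_cut p ->
       exists q : prog R, private_min_cut_algorithm eps K q /\
                          as_fast_as C q p).
Proof.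
exists 68, (fun c => (4 * (4 + c))%:R) => eps eps0; split=> [|p ps].
  exists (private_cut (2 / eps) (@brute_force R)).
  exact/private_cut_correct/brute_force_solves.
exists (private_cut (2 / eps) p); split; first exact: private_cut_correct.
by apply: private_cut_time; rewrite divr_gt0.
Qed.
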